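(* Let $R=k[x_1,\ldots,x_r]$ be a polynomial ring over a field $k$ and let $>$ be a monomial order on the monomials in $x_1,\ldots,x_r$ that respects total degree. Let $I\subseteq R$ be a monomial ideal of codimension $2$ such that $R/I$ is Cohen-Macaulay. Then there exist an extension field $K$ of $k$ and a prime ideal $P$ of the polynomial ring $S=K[x_1,\ldots,x_r]$ such that $\sqrt{\mathrm{in}(P)}=\sqrt{I}\,S$, where $\mathrm{in}(P)$ is the initial ideal of $P$ with respect to $>$.
   Context: A monomial order on a polynomial ring is a total order $\geq$ on its monomials such that $m\ge 1$ for every monomial $m$, and $m_1\geq m_2$ implies $nm_1\ge nm_2$ for all monomials $m_1,m_2,n$. It respects total degree if $\deg m_1>\deg m_2$ implies $m_1>m_2$. The same order $>$ is used on the monomials of $S=K[x_1,\ldots,x_r]$. For a nonzero polynomial $f$, $\mathrm{in}(f)$ is the largest term of $f$ (including its coefficient), and $\mathrm{in}(P)=\langle \mathrm{in}(f): f\in P,\ f\ne 0\rangle$. *)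

(* Defs.v *)
From HB Require Import structures.
From mathcomp Require Import all_boot all_order all_algebra.
From mathcomp Require Export mpoly.

Set Implicit Arguments.
Unset Strict Implicit.
Unset Printing Implicit Defensive.

Import GRing.Theory.

Local Open Scope ring_scope.

(* Ideals appear in two forms.  Proper ideals and prime ideals are the        *)
(* [idealr] and [prime_idealr] of ring_quotient; ideals built from a set of   *)
(* generators, which need not be proper or decidable, are predicates          *)
(* [A -> Prop].                                                               *)

Section Ideals.
Variable A : comNzRingType.

Definition ideal_span (X : A -> Prop) (a : A) : Prop :=
  exists (n : nat) (c x : 'I_n -> A),
    (forall i, X (x i)) /\ a = \sum_(i < n) c i * x i.

Definition radical (J : A -> Prop) (a : A) : Prop :=
  exists n : nat, J (a ^+ n.+1).

(* [idealr] excludes the unit ideal, so J ranges over proper ideals. *)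
Definition maximal_ideal (M : idealr A) : Prop :=
  forall J : idealr A, {subset M <= J} -> {subset J <= M}.

Definition prime_chain (p : prime_idealr A) (n : nat) : Prop :=
  exists q : 'I_n.+1 -> prime_idealr A,
    q ord_max =i p /\
    forall i j : 'I_n.+1, (i < j)%N ->
      {subset q i <= q j} /\ ~ {subset q j <= q i}.

Definition prime_codim (p : prime_idealr A) (n : nat) : Prop :=
  prime_chain p n /\ forall m, prime_chain p m -> (m <= n)%N.

(* Primes of infinite codimension satisfy no [prime_codim p m], and so do not *)
(* affect the minimum.                                                        *)
Definition ideal_codim (J : idealr A) (n : nat) : Prop :=
  (exists p : prime_idealr A, {subset J <= p} /\ prime_codim p n) /\
  forall (p : prime_idealr A) (m : nat),
    {subset J <= p} -> prime_codim p m -> (n <= m)%N.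

Definition seq_ideal (s : seq A) : A -> Prop := ideal_span (fun x => x \in s).

Definition regular_seq (s : seq A) : Prop :=
  ~ seq_ideal s 1 /\
  forall i, (i < size s)%N -> forall x,
    seq_ideal (take i s) (s`_i * x) -> seq_ideal (take i s) x.

Definition ideal_depth (J : idealr A) (d : nat) : Prop :=
  (exists s, [/\ regular_seq s, {subset s <= J} & size s = d]) /\
  forall s, regular_seq s -> {subset s <= J} -> (size s <= d)%N.

(* Eisenbud's definition, for a Noetherian ring A: depth M = codim M for every *)
(* maximal ideal M.  Both are finite in a Noetherian ring.                     *)
Definition cohen_macaulay : Prop :=
  forall M : idealr A, maximal_ideal M ->
    exists d, ideal_depth M d /\ ideal_codim M d.

End Ideals.

(* [ge m1 m2] is m1 >= m2.  The monoid of monomials ['X_{1..n}] is written     *)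
(* additively: the monomial 1 is [0%MM], the product of m and n is [m + n].    *)
Record monomial_order (n : nat) (ge : rel 'X_{1..n}) : Prop := MonomialOrder {
  mono_anti : antisymmetric ge;
  mono_trans : transitive ge;
  mono_total : total ge;
  mono_ge1 : forall m, ge m 0%MM;
  mono_mul : forall m1 m2 l, ge m1 m2 -> ge (l + m1)%MM (l + m2)%MM
}.

Definition respects_degree (n : nat) (ge : rel 'X_{1..n}) : Prop :=
  forall m1 m2, (mdeg m1 > mdeg m2)%N -> ge m1 m2 /\ m1 <> m2.

Section Monomials.
Variables (n : nat) (F : fieldType).

Definition monomial_ideal (I : idealr {mpoly F[n]}) : Prop :=
  exists G : 'X_{1..n} -> Prop, forall f,
    f \in I <-> ideal_span (fun g => exists2 m, G m & g = 'X_[m]) f.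

Definition initial_term (ge : rel 'X_{1..n}) (f t : {mpoly F[n]}) : Prop :=
  exists m, [/\ m \in msupp f, (forall m', m' \in msupp f -> ge m m')
              & t = f@_m *: 'X_[m]].

Definition initial_ideal (ge : rel 'X_{1..n}) (J : idealr {mpoly F[n]}) :
    {mpoly F[n]} -> Prop :=
  ideal_span (fun t => exists f, [/\ f \in J, f != 0 & initial_term ge f t]).

End Monomials.

Definition extended_ideal (n : nat) (k K : fieldType) (iota : {rmorphism k -> K})
    (J : {mpoly k[n]} -> Prop) : {mpoly K[n]} -> Prop :=
  ideal_span (fun g => exists2 f, J f & g = map_mpoly iota f).

(* Main.v *)
(** The radical of [I] is determined by the simplicial complex [D] whose missing
    faces are the minimal monomial primes over [I].  Evaluating Koszul homology
    at the points with coordinates [0] on [W] and [1] elsewhere turns the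
    Cohen-Macaulay hypothesis into the vanishing of the homology of [D]
    restricted to [W] in positive degrees.  Hence [D] is a flag complex, so that
    the radical of [I] is the cover ideal of the graph [G] of missing edges, and
    every induced subgraph of the complement of [G] has a simplicial vertex.

    Adding the vertices of [G] in the resulting order produces two homogeneous
    forms [f], [g] whose ideal has the cover ideal as radical.  Over
    [K = k(s, t)] the ideal [(f - s, g - t)] is prime, because it is the generic
    fibre of [(f, g)].  Its leading forms are those of [(f, g)] as [f], [g] is a
    regular sequence, and so the order enters only through the degree. *)

Require Import Defs.
From HB Require Import structures.
From mathcomp Require Import all_boot all_order all_algebra.
From mathcomp Require Import boolp.
From mathcomp Require Import mpoly zify ring.

Set Implicit Arguments.
Unset Strict Implicit.
Unset Printing Implicit Defensive.

Import GRing.Theory.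
Local Open Scope ring_scope.

(** * Ideals given by generators *)

(** Depth is tested at points of [V(I)]. A regular sequence of length [n - 2] in the maximal ideal
    of a point kills Koszul homology above degree [2]; a chain of linear subspaces inside a
    component [x_i = x_j = 0] supplies that length. Hence chains on simplices with at least three
    vertices can be filled: this is the homological form of a 2-linear resolution for the dual
    complex, from which Froeberg's and Dirac's theorems lead to elimination orders. The hypothesis
    concerns [R/I], whereas the complex sees only the radical of [I], so powers ['X_i ^+ N] replace
    the variables. Only the radical of the initial ideal is prescribed. It is enough that every
    initial monomial of the prime is a vertex cover and that a power of each squarefree cover
    monomial is an initial term. Both follow by comparing top degrees: the forms have positive
    degree, so subtracting constants changes lower degrees only. The ideal [(f, g)] has no reason to
    be prime, but transcendental constants turn its quotient into a localisation of the domain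
    [k[x]]. *)

Section IdealSpan.
Variable A : comNzRingType.
Implicit Types (X Y : A -> Prop) (a b c : A).

Lemma ideal_span_gen X a : X a -> ideal_span X a.
Proof.
move=> Xa; exists 1%N, (fun=> 1), (fun=> a); split=> //.
by rewrite big_ord_recl big_ord0 mul1r addr0.
Qed.

Lemma ideal_span0 X : ideal_span X 0.
Proof. by exists 0%N, (fun=> 0), (fun=> 0); split=> [[]|] //; rewrite big_ord0. Qed.

Lemma ideal_spanD X a b : ideal_span X a -> ideal_span X b -> ideal_span X (a + b).
Proof.
move=> [n1 [c1 [x1 [X1 ->]]]] [n2 [c2 [x2 [X2 ->]]]].
exists (n1 + n2)%N,
  (fun i => match split i with inl j => c1 j | inr j => c2 j end),
  (fun i => match split i with inl j => x1 j | inr j => x2 j end).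
split; first by move=> i; case: (split i).
rewrite big_split_ord /=; congr (_ + _); apply: eq_bigr => i _.
  by rewrite (unsplitK (inl i : 'I_n1 + 'I_n2)).
by rewrite (unsplitK (inr i : 'I_n1 + 'I_n2)).
Qed.

Lemma ideal_spanMl X c a : ideal_span X a -> ideal_span X (c * a).
Proof.
move=> [n [d [x [Xx ->]]]]; exists n, (fun i => c * d i), x; split=> //.
by rewrite big_distrr /=; apply: eq_bigr => i _; rewrite mulrA.
Qed.

Lemma ideal_spanN X a : ideal_span X a -> ideal_span X (- a).
Proof. by rewrite -mulN1r; apply: ideal_spanMl. Qed.

Lemma ideal_span_sum X (I : Type) (r : seq I) (P : pred I) (F : I -> A) :
  (forall i, P i -> ideal_span X (F i)) -> ideal_span X (\sum_(i <- r | P i) F i).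
Proof.
by move=> H; apply: big_ind => //; [exact: ideal_span0 | exact: ideal_spanD].
Qed.

Lemma ideal_span_min X (J : A -> Prop) :
  J 0 -> (forall a b, J a -> J b -> J (a + b)) ->
  (forall c a, J a -> J (c * a)) ->
  (forall a, X a -> J a) -> forall a, ideal_span X a -> J a.
Proof.
move=> J0 JD JM JX a [n [c [x [Xx ->]]]].
by apply: big_ind => // i _; apply: JM; apply: JX.
Qed.

Lemma ideal_span_mono X Y :
  (forall a, X a -> Y a) -> forall a, ideal_span X a -> ideal_span Y a.
Proof.
move=> XY; apply: ideal_span_min => [|||a /XY]; [exact: ideal_span0
  | exact: ideal_spanD | exact: ideal_spanMl | exact: ideal_span_gen].
Qed.

Lemma radical_ideal_spanD X a b :
  radical (ideal_span X) a -> radical (ideal_span X) b ->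
  radical (ideal_span X) (a + b).
Proof.
move=> [m Xa] [n Xb]; exists (m + n).+1; rewrite exprDn.
apply: ideal_span_sum => i _; rewrite -mulr_natl; apply: ideal_spanMl.
have [le_n|lt_n] := leqP n.+1 i.
  by rewrite -(subnK le_n) exprD mulrA; apply: ideal_spanMl.
have le_m : (m.+1 <= (m + n).+2 - i)%N by lia.
by rewrite mulrC -(subnK le_m) exprD mulrA; apply: ideal_spanMl.
Qed.

Lemma radical_ideal_spanM X c a :
  radical (ideal_span X) a -> radical (ideal_span X) (c * a).
Proof. by move=> [m Xa]; exists m; rewrite exprMn; apply: ideal_spanMl. Qed.

Lemma radical_ideal_span X a : ideal_span X a -> radical (ideal_span X) a.
Proof. by exists 0%N. Qed.

Lemma seq_ideal_rcons (s : seq A) b a :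
  seq_ideal (rcons s b) a -> exists c, seq_ideal s (a - b * c).
Proof.
apply: (@ideal_span_min _ (fun a => exists c, seq_ideal s (a - b * c))).
- by exists 0; rewrite mulr0 subr0; apply: ideal_span0.
- move=> a1 a2 [c1 H1] [c2 H2]; exists (c1 + c2).
  by rewrite mulrDr opprD addrACA; apply: ideal_spanD.
- move=> d a1 [c1 H1]; exists (d * c1).
  by rewrite mulrCA -mulrBr; apply: ideal_spanMl.
move=> x; rewrite mem_rcons inE => /orP[/eqP->|xs].
  by exists 1; rewrite mulr1 subrr; apply: ideal_span0.
by exists 0; rewrite mulr0 subr0; apply: ideal_span_gen.
Qed.

Lemma seq_ideal_rcons_mono (s : seq A) b a :
  seq_ideal s a -> seq_ideal (rcons s b) a.
Proof.
by apply: ideal_span_mono => x xs; rewrite mem_rcons inE xs orbT.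
Qed.

Lemma seq_ideal_rconsM (s : seq A) b a : seq_ideal (rcons s b) (b * a).
Proof.
by rewrite mulrC; apply: ideal_spanMl; apply: ideal_span_gen; rewrite mem_rcons mem_head.
Qed.

End IdealSpan.

(** * Koszul complexes *)

Section Koszul.
Variables (A : comNzRingType) (n : nat).
Implicit Types (y : 'I_n -> A) (f g : {set 'I_n} -> A) (t : {set 'I_n}).

(* A chain is a function on the subsets [t] of the index set, [f t] being the *)
(* coefficient of the exterior monomial [e_t]. *)
Definition ksign (j : 'I_n) t : A := (-1) ^+ #|[set i in t | (i < j)%N]|.

Definition kdiff y f t : A := \sum_(j | j \notin t) ksign j t * (y j * f (j |: t)).

(** Left exterior multiplication by [e_l]. *)
Definition khom (l : 'I_n) f t : A :=
  if l \in t then ksign l t * f (t :\ l) else 0.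

Definition kdeg (d : nat) f : Prop := forall t, #|t| != d -> f t = 0.

Lemma ksignU1 j k t : k \notin t ->
  ksign j (k |: t) = (-1) ^+ (k < j)%N * ksign j t.
Proof.
move=> kt; rewrite /ksign -exprD; congr (_ ^+ _).
have [kj|kj] := ltnP k j.
  rewrite (_ : [set i in k |: t | _] = k |: [set i in t | (i < j)%N]).
    by rewrite cardsU1 !inE (negPf kt).
  by apply/setP=> i; rewrite !inE; case: eqP => [->|].
rewrite add0n; apply: eq_card => i; rewrite !inE.
by case: eqP => [->|] //=; rewrite ltnNge kj andbF.
Qed.

Lemma ksignU1_id l t : ksign l (l |: t) = ksign l t.
Proof.
have [lt|lt] := boolP (l \in t); first by rewrite (setUidPr _) ?sub1set.
by rewrite ksignU1 // ltnn mul1r.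
Qed.

Lemma ksignD1_id l t : ksign l (t :\ l) = ksign l t.
Proof.
have [lt|lt] := boolP (l \in t); first by rewrite -[in RHS](setD1K lt) ksignU1_id.
by rewrite (setDidPl _) // disjoint_sym disjoints1.
Qed.

Lemma ksign_sq l t : ksign l t * ksign l t = 1.
Proof. by rewrite -expr2 sqrr_sign. Qed.

Lemma ksign_swap j k t : j != k -> j \notin t -> k \notin t ->
  ksign k t * ksign j (k |: t) = - (ksign j t * ksign k (j |: t)).
Proof.
move=> jk jt kt; rewrite !ksignU1 // mulrCA (mulrCA (ksign j t)) (mulrC (ksign j t)) -mulNr.
congr (_ * _); move: jk; rewrite -val_eqE /=.
by case: ltngtP => //= _ _; rewrite ?expr0 ?expr1 ?opprK.
Qed.

Lemma kdiffD y f g t : kdiff y (fun s => f s + g s) t = kdiff y f t + kdiff y g t.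
Proof. by rewrite -big_split; apply: eq_bigr => j _ /=; rewrite !mulrDr. Qed.

Lemma kdiffZ y a f t : kdiff y (fun s => a * f s) t = a * kdiff y f t.
Proof. by rewrite big_distrr; apply: eq_bigr => j _ /=; rewrite !(mulrCA a). Qed.

Lemma kdiffB y f g t : kdiff y (fun s => f s - g s) t = kdiff y f t - kdiff y g t.
Proof.
by rewrite -mulN1r -kdiffZ -kdiffD; apply: eq_bigr => j _; rewrite mulN1r.
Qed.

Lemma kdiff_deg y d f : kdeg d.+1 f -> kdeg d (kdiff y f).
Proof.
move=> df t td; apply: big1 => j jt.
by rewrite df ?mulr0 // cardsU1 jt add1n eqSS.
Qed.

Lemma khom_deg l d f : kdeg d f -> kdeg d.+1 (khom l f).
Proof.
move=> df t td; rewrite /khom; case: ifP => // lt.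
by rewrite df ?mulr0 //; apply: contraNneq td => <-; rewrite (cardsD1 l t) lt.
Qed.

Lemma kdiff_sq y f t : kdiff y (kdiff y f) t = 0.
Proof.
pose F (p : 'I_n * 'I_n) :=
  ksign p.1 t * (y p.1 * (ksign p.2 (p.1 |: t) * (y p.2 * f (p.2 |: (p.1 |: t))))).
pose P (p : 'I_n * 'I_n) := [&& p.1 \notin t, p.2 \notin t & p.1 != p.2].
have -> : kdiff y (kdiff y f) t = \sum_(p | P p) F p.
  transitivity (\sum_(j | j \notin t) \sum_(k | k \notin j |: t) F (j, k)).
    by apply: eq_bigr => j _; rewrite !big_distrr.
  rewrite pair_big_dep; apply: eq_bigl => -[j k]; rewrite /P !inE /= negb_or.
  by rewrite (eq_sym k); case: (j \notin t); case: (k \notin t); rewrite ?andbT ?andbF.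
rewrite (bigID (fun p : 'I_n * 'I_n => p.1 < p.2)%N) /=.
rewrite [X in _ + X](reindex_inj (can_inj swap_pairK)) /=.
apply/eqP; rewrite addrC addr_eq0 -sumrN; apply/eqP; apply: eq_big => [[j k]|[j k]].
  rewrite /P /= [k == j]eq_sym -val_eqE /= -leqNgt leq_eqVlt.
  by case: (k \notin t); case: (j \notin t); case: ltngtP.
rewrite /P /= => /andP[/and3P[kt jt kj] _].
have E := ksign_swap kj kt jt; rewrite /F /= (setUCA [set j]).
set w := f _; transitivity (ksign k t * ksign j (k |: t) * (y k * y j * w)); first by ring.
by rewrite -[ksign k t * _]opprK -E; ring.
Qed.

Lemma kdiff_khom y l f t :
  kdiff y (khom l f) t + khom l (kdiff y f) t = y l * f t.
Proof.
rewrite /khom; have [lt|lt] := boolP (l \in t); last first.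
  rewrite addr0 /kdiff (bigD1 l) //= setU11 ksignU1_id setU1K // big1 ?addr0.
    by rewrite mulrCA (mulrA (ksign l t)) ksign_sq mul1r.
  move=> j /andP[jt jl]; rewrite in_setU1 (negPf lt) orbF eq_sym (negPf jl).
  by rewrite !mulr0.
rewrite {2}/kdiff (bigD1 l) /=; last by rewrite !inE eqxx.
rewrite ksignD1_id setD1K // mulrDr (mulrA (ksign l t)) ksign_sq mul1r addrCA.
rewrite -[RHS]addr0; congr (_ + _).
rewrite big_distrr /= (eq_bigl (fun j => j \notin t)); last first.
  move=> j; rewrite !inE negb_and negbK; case: eqP => [->|] /=; first by rewrite lt.
  by rewrite andbT.
rewrite -big_split big1 //= => j jt.
have jl : j != l by apply: contraNneq jt => ->.
rewrite in_setU1 lt orbT setDUl (_ : [set j] :\ l = [set j]); last first.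
  by apply/setP=> i; rewrite !inE; case: eqP => [->|]; rewrite ?andbF // eq_sym (negPf jl).
have sl : j |: t :\ l = (j |: t) :\ l.
  by apply/setP=> i; rewrite !inE; case: eqP => [->|] /=; rewrite ?andbT // (negPf jl).
have := @ksign_swap j l (t :\ l) jl; rewrite !inE eqxx (negPf jt) andbF /=.
move=> /(_ isT isT); rewrite setD1K // ksignD1_id sl ksignD1_id.
set w := f _; set a := ksign l (j |: t); set b := ksign j t.
set c := ksign l t; set d := ksign j (t :\ l) => E.
have -> : b * (y j * (a * w)) + c * (d * (y j * w)) = (b * a + c * d) * (y j * w).
  by ring.
suff -> : b * a + c * d = 0 by rewrite mul0r.
have -> : b * a = (c * c) * (b * a) by rewrite ksign_sq mul1r.
have -> : c * c * (b * a) = c * b * (c * a) by ring.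
have -> : c * d = d * c * (a * a) by rewrite ksign_sq mulr1 mulrC.
by rewrite E; ring.
Qed.

(* Each [y l] acts as zero on homology, by the homotopy [khom l]. *)
Lemma ideal_kills_homology y (J : A -> Prop) b d f :
  ideal_span (fun x => exists l, x = y l) b ->
  (forall t, ideal_span J (kdiff y f t)) -> kdeg d f ->
  exists2 g, kdeg d.+1 g & forall t, ideal_span J (b * f t - kdiff y g t).
Proof.
move=> yb Jf df; move: b yb; apply: ideal_span_min.
- exists (fun=> 0) => // t; rewrite mul0r sub0r; apply: ideal_spanN.
  by apply: ideal_span_sum => j _; rewrite !mulr0; apply: ideal_span0.
- move=> b1 b2 [g1 d1 H1] [g2 d2 H2]; exists (fun s => g1 s + g2 s).
    by move=> t td; rewrite d1 ?d2 ?addr0.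
  by move=> t; rewrite kdiffD mulrDl opprD addrACA; apply: ideal_spanD.
- move=> c b1 [g1 d1 H1]; exists (fun s => c * g1 s).
    by move=> t td; rewrite d1 ?mulr0.
  by move=> t; rewrite kdiffZ -mulrA -mulrBr; apply: ideal_spanMl.
move=> _ [l ->]; exists (khom l f); first exact: khom_deg.
move=> t; rewrite -(kdiff_khom y l f t) addrC addKr.
rewrite /khom; case: ifP => _; last exact: ideal_span0.
exact: ideal_spanMl.
Qed.

Lemma kdiff_ideal y (J : A -> Prop) f t :
  (forall s, ideal_span J (f s)) -> ideal_span J (kdiff y f t).
Proof. by move=> Jf; apply: ideal_span_sum => j _; do 2!apply: ideal_spanMl. Qed.

(* Depth sensitivity: dividing out a regular sequence one element [b] at a    *)
(* time, a cycle killed by [b] modulo boundaries is a boundary, because its   *)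
(* primitive is a cycle one degree higher modulo [b]. *)
Lemma koszul_depth y (s : seq A) : regular_seq s ->
  (forall b, b \in s -> radical (ideal_span (fun x => exists l, x = y l)) b) ->
  forall i j d f, (j + i = size s)%N -> (n < d + i)%N -> kdeg d f ->
  (forall t, seq_ideal (take j s) (kdiff y f t)) ->
  exists2 g, kdeg d.+1 g & forall t, seq_ideal (take j s) (f t - kdiff y g t).
Proof.
move=> [_ reg] ys; elim=> [|i IHi] j d f ji ndi df Jf.
  exists (fun=> 0) => // t; rewrite /kdiff big1 ?subr0 => [|k _]; last by rewrite !mulr0.
  rewrite df; first exact: ideal_span0.
  by apply: contraTneq ndi => <-; rewrite addn0 -leqNgt -[X in (_ <= X)%N]card_ord max_card.
have js : (j < size s)%N by rewrite -ji addnS ltnS leq_addr.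
set b := s`_j; have takeS : take j.+1 s = rcons (take j s) b by rewrite (take_nth 0).
have {}reg x : seq_ideal (take j s) (b * x) -> seq_ideal (take j s) x by exact: reg.
have [m ybm] : radical (ideal_span (fun x => exists l, x = y l)) b.
  by apply: ys; apply: mem_nth.
have step f' : kdeg d f' -> (forall t, seq_ideal (take j s) (kdiff y f' t)) ->
    forall g, kdeg d.+1 g -> (forall t, seq_ideal (take j s) (b * f' t - kdiff y g t)) ->
  exists2 g', kdeg d.+1 g' & forall t, seq_ideal (take j s) (f' t - kdiff y g' t).
  move=> df' Jf' g dg Hg.
  have [h dh Hh] : exists2 h, kdeg d.+2 h &
      forall t, seq_ideal (take j.+1 s) (g t - kdiff y h t).
    apply: IHi dg _; rewrite ?addSnnS // => t; rewrite takeS.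
    rewrite -[kdiff _ _ _](subrK (b * f' t)); apply: ideal_spanD.
      by rewrite -opprB; apply/ideal_spanN/seq_ideal_rcons_mono.
    exact: seq_ideal_rconsM.
  (* Ideal membership does not control the support of [c], so [c] is set to [0] off degree
     [d.+1]. *)
  have /fin_all_exists[c Hc] t : exists c, (#|t| != d.+1 -> c = 0) /\
      seq_ideal (take j s) (g t - kdiff y h t - b * c).
    have [td|td] := eqVneq #|t| d.+1.
      by move: (Hh t); rewrite takeS => /seq_ideal_rcons[c]; exists c.
    exists 0; split=> //; rewrite dg // (kdiff_deg y dh) // mulr0 !subr0.
    exact: ideal_span0.
  exists c => [t|t]; first by case: (Hc t).
  apply: reg; rewrite mulrBr.
  rewrite (_ : _ - _ = (b * f' t - kdiff y g t)
      + kdiff y (fun s => g s - kdiff y h s - b * c s) t).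
    apply: ideal_spanD; first exact: Hg.
    apply: (@kdiff_ideal y (fun x => x \in take j s)) => s'.
    by have [_ HH] := Hc s'.
  by rewrite !kdiffB kdiff_sq kdiffZ subr0 addrA subrK.
(* Only [b ^+ m.+1] is known to lie in the ideal of the [y l], so the homotopy fills
   [b ^+ m.+1 * f]; [step] then cancels the factors [b] one by one. *)
have pow p : (p <= m.+1)%N -> exists2 g, kdeg d.+1 g &
    forall t, seq_ideal (take j s) (b ^+ (m.+1 - p) * f t - kdiff y g t).
  elim: p => [|p IHp] pm.
    rewrite subn0; exact: (@ideal_kills_homology y (fun x => x \in take j s) _ d).
  have [g dg Hg] := IHp (ltnW pm).
  refine (step (fun t => b ^+ (m.+1 - p.+1) * f t) _ _ g dg _) => t.
  - by move=> td; rewrite df ?mulr0.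
  - by rewrite kdiffZ; apply/ideal_spanMl/Jf.
  by rewrite mulrA -exprS -subSn // subSS.
by have [//|g dg Hg] := pow m.+1; exists g => // t; move: (Hg t); rewrite subnn mul1r.
Qed.
End Koszul.

(** * Flag complexes and elimination orders *)

Section Chains.
Variables (k : fieldType) (n : nat).
Implicit Types (f g c u p : {set 'I_n} -> k) (s t S W : {set 'I_n}) (i j : 'I_n).

Definition bdry f t : k := kdiff (fun=> 1) f t.

Definition single S t : k := (t == S)%:R.

Lemma single_deg S : kdeg #|S| (single S).
Proof. by move=> t; rewrite /single; have [->|//] := eqVneq t S; rewrite eqxx. Qed.

Lemma single_neq0 S t : single S t != 0 -> t = S.
Proof. by rewrite /single; have [|_ /eqP] := eqVneq t S. Qed.

Lemma ksign_neq0 i t : ksign k i t != 0.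
Proof. by rewrite signr_eq0. Qed.

Lemma ksign_set1 i : ksign k i [set i] = 1.
Proof.
rewrite /ksign (_ : [set _ in _ | _] = set0) ?cards0 //.
by apply/setP=> j; rewrite !inE; case: eqP => // ->; rewrite ltnn.
Qed.

Lemma bdry_support f S j : (forall t, t != S -> f t = 0) -> j \in S ->
  bdry f (S :\ j) = ksign k j S * f S.
Proof.
move=> fS jS; rewrite /bdry /kdiff (bigD1 j) /=; last by rewrite !inE eqxx.
rewrite setD1K // mul1r ksignD1_id big1 ?addr0 // => i /andP[iS ij].
rewrite fS ?mulr0 //; apply: contraNneq iS => E.
by rewrite in_setD1 ij -E setU11.
Qed.

(** With all [y j = 1], [khom l] is the cone with apex [l], and [kdiff_khom] becomes the boundary
    formula for a cone. *)
Lemma bdry_khom l f t : bdry (khom l f) t = f t - khom l (bdry f) t.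
Proof. by rewrite -[f t]mul1r -(kdiff_khom (fun=> 1) l f t) addrK. Qed.

Lemma bdry_neq0 f t : bdry f t != 0 -> exists2 j, j \notin t & f (j |: t) != 0.
Proof.
move=> ft; suff /existsP[j /andP[jt fj]] : [exists j, (j \notin t) && (f (j |: t) != 0)].
  by exists j.
apply: contraNT ft => /existsPn H; rewrite /bdry /kdiff big1 // => j jt.
by have := H j; rewrite jt negbK => /eqP->; rewrite !mulr0.
Qed.

Lemma bdry_single S t : bdry (single S) t != 0 -> exists2 j, j \in S & t = S :\ j.
Proof.
move=> /bdry_neq0[j jt] /single_neq0 <-.
by exists j; rewrite ?setU11 // setU1K.
Qed.

Variable D : {set {set 'I_n}}.

Definition nonface2 i j := [set i; j] \notin D.

(* Homology vanishing, in degrees at least [1], of the restriction of [D] to  *)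
(* every [W] that contains a missing edge; [d] is the number of vertices of   *)
(* the simplices in [u], hence the bound [3]. *)
Definition filling : Prop := forall W d u,
  (exists i j, [/\ i \in W, j \in W & nonface2 i j]) -> (3 <= d)%N -> kdeg d u ->
  (forall t, u t != 0 -> t \subset W) -> (forall t, bdry u t != 0 -> t \in D) ->
  exists c, [/\ kdeg d c, forall t, c t != 0 -> t \in D /\ t \subset W
              & forall t, bdry c t = bdry u t].

Hypothesis D_sub : forall s t, s \subset t -> t \in D -> s \in D.
Hypothesis D1 : forall i, [set i] \in D.
Hypothesis D_fill : filling.

Local Notation G := nonface2.

Lemma nonface2C i j : G i j = G j i.
Proof. by rewrite /nonface2 setUC. Qed.

Lemma nonface2_irr i : G i i = false.
Proof. by rewrite /nonface2 setUid D1. Qed.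

Lemma nonface2_sub i j t : G i j -> i \in t -> j \in t -> t \notin D.
Proof.
move=> ij it jt; apply: contra ij; apply: D_sub.
by rewrite subUset !sub1set it.
Qed.

Lemma min_nonface s : s \notin D ->
  exists S, [/\ S \subset s, S \notin D & forall i, i \in S -> S :\ i \in D].
Proof.
move=> sD; have [S /minsetP[SD Smin] Ss] :=
  @minset_exists _ [pred t | t \notin D] s sD.
exists S; split=> // i iS; apply: contraT => SiD.
by have := Smin _ SiD (subD1set _ _) => E; move: iS; rewrite -E !inE eqxx.
Qed.

Lemma min_nonface_card S : (exists i j, G i j) -> S \notin D ->
  (forall i j, i \in S -> j \in S -> ~~ G i j) -> (3 <= #|S|)%N.
Proof.
move=> [a _] SD nG; case E : #|S| => [|[|[|m]]] //; case/negP: SD.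
- by move/eqP: E; rewrite cards_eq0 => /eqP->; apply: D_sub (D1 a); apply: sub0set.
- by have /cards1P[i ->] : #|S| == 1%N by rewrite E.
have /cards2P[i [j [_ SE]]] : #|S| == 2%N by rewrite E.
by have := nG i j; rewrite SE !inE !eqxx orbT negbK; apply.
Qed.

(** If [a], [b] were a missing edge, some chain of faces inside [b |: S] would have the same
    boundary as [S]. Its simplices contain [b], as [S] is no face, hence avoid [a]; only
    [b |: S :\ a] remains. That simplex has facets through [b], absent from the boundary of [S], so
    the chain is zero, while the boundary of [S] is not. *)
Lemma nonface_isolated S a b : S \notin D -> (forall i, i \in S -> S :\ i \in D) ->
  (forall i j, i \in S -> j \in S -> ~~ G i j) -> a \in S -> ~~ G a b.
Proof.
move=> SD Smin nG aS; apply/negP=> ab.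
have bS : b \notin S by apply: contraL ab => bS; apply: nG.
have S3 : (3 <= #|S|)%N by apply: min_nonface_card => //; exists a, b.
have [|t|t /bdry_single[i iS ->]|c [cd cD cu]] :=
    @D_fill (b |: S) _ (single S) _ S3 (@single_deg S).
- by exists a, b; rewrite !inE aS eqxx orbT.
- by move=> /single_neq0->; apply: subsetUr.
- exact: Smin.
have cT t : t != b |: S :\ a -> c t = 0.
  move=> tT; apply/eqP; apply: contraNT tT => ct.
  have [tD tW] := cD t ct; have tS : #|t| == #|S|.
    by apply: contraNT ct => /cd->.
  have bt : b \in t.
    apply: contraNT SD => bt; have tSs : t \subset S.
      by apply/subsetP=> i it; have := subsetP tW i it; rewrite !inE; case: eqP it bt => // -> ->.
    by have /eqP <- : t == S by rewrite eqEcard tSs (eqP tS) leqnn.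
  have at' : a \notin t by apply: contraL tD => at'; apply: nonface2_sub ab _ _.
  rewrite eqEcard; apply/andP; split.
    apply/subsetP=> i it; have := subsetP tW i it; rewrite !inE.
    by case: (i == b) => //= ->; rewrite andbT; apply: contraNneq at' => <-.
  by rewrite cardsU1 !inE (negPf bS) andbF add1n (eqP tS) [X in (_ <= X)%N](cardsD1 a) aS.
have cT0 : c (b |: S :\ a) = 0.
  have [j] : exists j, j \in S :\ a.
    by apply/set0Pn; rewrite -card_gt0; move: S3; rewrite (cardsD1 a) aS; case: #|_|.
  move=> jSa; have jT : j \in b |: S :\ a by rewrite inE jSa orbT.
  have := bdry_support cT jT; rewrite cu.
  have [->|/bdry_single[i iS E]] := eqVneq (bdry (single S) ((b |: S :\ a) :\ j)) 0.
    by move/esym/eqP; rewrite mulf_eq0 (negPf (ksign_neq0 _ _)) => /eqP.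
  have : b \in S :\ i.
    by rewrite -E !inE eqxx andbT; apply: contraNneq bS => ->; move: jSa; rewrite inE => /andP[].
  by rewrite inE (negPf bS) andbF.
have c0 t : c t = 0 by have [->|/cT] := eqVneq t (b |: S :\ a).
have := cu (S :\ a); rewrite (@bdry_support (single S) S) // => [|t]; last first.
  by apply: contraNeq => /single_neq0 ->.
rewrite /single eqxx mulr1 /bdry /kdiff big1 => [|i _]; last by rewrite c0 !mulr0.
by move/esym/eqP; rewrite (negPf (ksign_neq0 _ _)).
Qed.

(* Otherwise a missing face [S] with more than two vertices, together with a  *)
(* missing edge [{a, b}], yields the suspension of the boundary of [S]: a     *)
(* sphere that bounds nothing. *)
Lemma flag s : (exists i j, G i j) -> s \notin D ->
  exists i j, [/\ i \in s, j \in s & G i j].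
Proof.
move=> exG; have [a [b ab]] := exG.
move=> /min_nonface[S [Ss SD Smin]].
suff [i [j [iS jS ij]]] : exists i j, [/\ i \in S, j \in S & G i j].
  by exists i, j; split=> //; apply: (subsetP Ss).
have [/existsP[i /existsP[j /and3P[iS jS ij]]]|] :=
    boolP [exists i, exists j, [&& i \in S, j \in S & G i j]].
  by exists i, j.
move=> noG; have {noG}nG i j : i \in S -> j \in S -> ~~ G i j.
  move=> iS jS; apply: contra noG => ij.
  by apply/existsP; exists i; apply/existsP; exists j; rewrite iS jS.
exfalso; have S3 : (3 <= #|S|)%N by apply: min_nonface_card.
have iso i v : i \in S -> ~~ G i v by move=> iS; apply: nonface_isolated iS.
have aS : a \notin S by apply: contraL ab => aS; apply: iso.
have bS : b \notin S by apply: contraL ab => aS'; rewrite nonface2C; apply: iso.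
(* A minimal nonface [T] in [v |: S :\ i] contains [v], and contains no missing edge because the
   vertices of [S] are isolated in [G]. By [nonface_isolated] for [T], [v] is isolated too, against
   [G v w]. *)
have facet v w i : G v w -> v \notin S -> i \in S -> v |: S :\ i \in D.
  move=> vw vS iS; apply: contraT => /min_nonface[T [Tsub TD Tmin]].
  have vT : v \in T.
    apply: contraNT TD => vT; apply: D_sub (Smin i iS); apply/subsetP=> x xT.
    by have := subsetP Tsub x xT; rewrite in_setU1; case: eqP xT vT => // -> ->.
  have TS x : x \in T -> x != v -> x \in S.
    by move=> xT xv; have := subsetP Tsub x xT; rewrite !inE (negPf xv) => /andP[].
  suff : ~~ G v w by rewrite vw.
  apply: nonface_isolated TD Tmin _ vT => x y xT yT.
  have [xv|xv] := eqVneq x v; last by apply: iso; apply: TS.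
  have [yv|yv] := eqVneq y v; last by rewrite nonface2C; apply: iso; apply: TS.
  by rewrite xv yv nonface2_irr.
have ba : G b a by rewrite nonface2C.
pose h v := khom v (bdry (single S)).
have hD v w t : G v w -> v \notin S -> h v t != 0 ->
    exists2 i, i \in S & t = v |: S :\ i.
  rewrite /h /khom => vw vS; case: ifP => [vt|]; last by rewrite eqxx.
  rewrite mulf_eq0 negb_or => /andP[_ /bdry_single[i iS E]].
  by exists i => //; rewrite -E setD1K.
pose u t := khom a (single S) t - khom b (single S) t.
have bu t : bdry u t = h b t - h a t.
  rewrite /bdry kdiffB -!/(bdry _ _) !bdry_khom /h; ring.
have uW v t : khom v (single S) t != 0 -> t = v |: S.
  rewrite /khom; case: ifP => [vt|]; last by rewrite eqxx.
  by rewrite mulf_eq0 negb_or => /andP[_ /single_neq0 <-]; rewrite setD1K.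
have ab' : a != b by apply: contraTneq ab => ->; rewrite nonface2_irr.
have [|||t|t|c [cd cD cu]] := @D_fill (a |: (b |: S)) #|S|.+1 u.
- by exists a, b; rewrite !inE !eqxx orbT.
- by apply: leqW.
- by move=> t td; rewrite /u !(khom_deg _ (single_deg (S := S))) ?subr0.
- rewrite /u => ut; have : (khom a (single S) t != 0) || (khom b (single S) t != 0).
    by rewrite -negb_and; apply: contraNN ut => /andP[/eqP-> /eqP->]; rewrite subr0.
  case/orP=> /uW ->; apply/subsetP=> x; rewrite !inE; first by case/orP=> ->; rewrite ?orbT.
  by case/orP=> ->; rewrite ?orbT.
- rewrite bu => ut; have : (h a t != 0) || (h b t != 0).
    by rewrite -negb_and; apply: contraNN ut => /andP[/eqP-> /eqP->]; rewrite subr0.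
  case/orP=> [/(hD _ _ _ ab aS)[i iS ->]|/(hD _ _ _ ba bS)[i iS ->]].
    exact: facet ab aS iS.
  exact: facet ba bS iS.
(* A simplex of [c] omits exactly one vertex of [a |: (b |: S)]. That vertex lies in [S], since [S]
   is no face, so the simplex would contain the missing edge [a], [b]. *)
have c0 t : c t = 0.
  apply/eqP; apply: contraT => ct; have [tD tW] := cD t ct.
  have tS : #|t| == #|S|.+1 by apply: contraNT ct => /cd->.
  have St : ~~ (S \subset t) by apply: contra SD => St; apply: D_sub tD.
  have /subsetPn[i iS it] := St.
  have iWt : i \in (a |: (b |: S)) :\: t by rewrite !inE it iS !orbT.
  have /cards1P[x Wt] : #|(a |: (b |: S)) :\: t| == 1%N.
    by rewrite cardsD (setIidPr tW) !cardsU1 in_setU1 negb_or ab' aS bS (eqP tS) !add1n subSnn.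
  have xi v : v \in a |: (b |: S) -> v != i -> v \in t.
    move=> vW vi; apply: contraNT vi => vt.
    have : v \in (a |: (b |: S)) :\: t by rewrite !inE in vW *; rewrite vt.
    by move: iWt; rewrite Wt !inE => /eqP-> /eqP->.
  have := nonface2_sub ab (xi a _ _) (xi b _ _); rewrite tD !inE !eqxx orbT.
  by apply=> //; [apply: contraNneq aS | apply: contraNneq bS] => ->.
have [i iS] : exists i, i \in S by apply/set0Pn; rewrite -card_gt0; apply: ltnW; apply: ltnW.
have : bdry u (b |: S :\ i) == 0.
  by rewrite -cu /bdry /kdiff big1 // => j _; rewrite c0 !mulr0.
have aT : a \notin b |: S :\ i by rewrite !inE (negPf ab') (negPf aS) andbF.
rewrite bu /h /khom setU11 (negPf aT) subr0 setU1K ?inE ?(negPf bS) ?andbF //.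
rewrite (@bdry_support (single S) S) // /single ?eqxx ?mulr1 => [|t]; last by move/negPf->.
by rewrite mulf_eq0 !(negPf (ksign_neq0 _ _)).
Qed.

(** Connectedness is recorded by a chain of edges instead of a path, because a chain can be coned
    and passed to [filling]. *)
Definition joined (B : {set 'I_n}) i j : Prop := exists p, [/\ kdeg 2 p,
  forall t, p t != 0 -> t \in D /\ t \subset B
  & forall t, bdry p t = single [set j] t - single [set i] t].

Lemma joined_trans (B : {set 'I_n}) i j l : joined B i j -> joined B j l -> joined B i l.
Proof.
move=> [p [dp pD pb]] [q [dq qD qb]]; exists (fun t => p t + q t); split.
- by move=> t td; rewrite dp ?dq ?addr0.
- move=> t; have [->|/pD //] := eqVneq (p t) 0.
  by rewrite add0r => /qD.
- by move=> t; rewrite /bdry kdiffD -!/(bdry _ _) pb qb addrC addrA subrK.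
Qed.

Lemma joined_edge (B : {set 'I_n}) i j : i \in B -> j \in B -> ~~ G i j -> joined B i j.
Proof.
move=> iB jB ij; have [<-|nij] := eqVneq i j.
  exists (fun=> 0); split=> // t; first by rewrite eqxx.
  by rewrite subrr /bdry /kdiff big1 // => l _; rewrite !mulr0.
exists (khom i (single [set j])); split.
- by apply: khom_deg; rewrite -(cards1 j); apply: single_deg.
- move=> t; rewrite /khom; case: ifP => [it|]; last by rewrite eqxx.
  rewrite mulf_eq0 negb_or => /andP[_ /single_neq0 E].
  by rewrite -(setD1K it) E -/(nonface2 _ _) -[_ \in D]negbK ij subUset !sub1set iB.
move=> t; rewrite bdry_khom; congr (_ - _); rewrite /khom /single.
case: ifP => [it|it]; last first.
  by have [E|//] := eqVneq t [set i]; move: it; rewrite E inE eqxx.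
have [t0|t0] := eqVneq t [set i]; last first.
  have [->|/bdry_single[l]] := eqVneq (bdry (single [set j]) (t :\ i)) 0.
    by rewrite mulr0.
  rewrite inE => /eqP-> E; move: t0; rewrite -(setD1K it) E.
  by rewrite setDv setU0 eqxx.
rewrite t0 setDv -(setDv [set j]) -[[set j] :\: [set j]]/([set j] :\ j).
rewrite (@bdry_support _ [set j]) ?inE // => [|s]; last by rewrite /single => /negPf->.
by rewrite !ksign_set1 /single eqxx !mulr1.
Qed.

Lemma joined_connect (B : {set 'I_n}) (e : rel 'I_n) i j :
  (forall x y, e x y -> [/\ x \in B, y \in B & ~~ G x y]) -> i \in B ->
  connect e i j -> joined B i j.
Proof.
move=> eB iB /connectP[q]; elim: q i iB => [|l q IHq] i iB /=.
  by move=> _ ->; apply: joined_edge; rewrite ?nonface2_irr.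
case/andP=> /eB[_ lB il] lq jl.
by apply: joined_trans (joined_edge iB lB il) _; apply: IHq.
Qed.

(* A path from [x] to [y] through [A], closed up through [b], is a cycle that *)
(* bounds nothing, since no triangle contains [b]. *)
Lemma no_separating_pair (A : {set 'I_n}) b x y :
  G x y -> ~~ G b x -> ~~ G b y -> b != x -> b != y ->
  (forall i, i \in A -> G b i) -> ~ joined (x |: (y |: A)) x y.
Proof.
move=> xy bx' by' nbx nby bA [p [dp pD pb]].
have bA' : b \notin A by apply/negP=> /bA; rewrite nonface2_irr.
have [|||t|t|c [cd cD cu]] := @D_fill (b |: (x |: (y |: A))) 3 (khom b p).
- by exists x, y; rewrite !inE !eqxx !orbT.
- by [].
- exact: khom_deg.
- rewrite /khom; case: ifP => [bt|]; last by rewrite eqxx.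
  rewrite mulf_eq0 negb_or => /andP[_ /pD[_]].
  by rewrite -{2}(setD1K bt) => /(setUS [set b]).
- rewrite bdry_khom; have [->|/pD[] //] := eqVneq (p t) 0.
  rewrite sub0r oppr_eq0 /khom; case: ifP => [bt|]; last by rewrite eqxx.
  rewrite mulf_eq0 negb_or pb => /andP[_ E].
  have : (single [set y] (t :\ b) != 0) || (single [set x] (t :\ b) != 0).
    by rewrite -negb_and; apply: contraNN E => /andP[/eqP-> /eqP->]; rewrite subr0.
  case/orP=> /single_neq0 E'; rewrite -(setD1K bt) E'; first by move: by'; rewrite negbK.
  by move: bx'; rewrite negbK.
have : bdry (khom b p) [set b; x] == 0.
  rewrite -cu; apply: contraT => /bdry_neq0[j]; rewrite !inE negb_or => /andP[jb jx].
  move=> /cD[tD /subsetP/(_ j)]; rewrite !inE eqxx (negPf jb) (negPf jx) /= => /(_ isT).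
  case/orP=> [/eqP jy|jA].
    by move: tD; rewrite (negPf (nonface2_sub xy _ _)) // !inE ?eqxx ?orbT // jy eqxx.
  by move: tD; rewrite (negPf (nonface2_sub (bA j jA) _ _)) // !inE eqxx ?orbT.
rewrite bdry_khom; have -> : p [set b; x] = 0.
  apply/eqP; apply: contraT => /pD[_ /subsetP/(_ b)]; rewrite !inE eqxx => /(_ isT).
  by rewrite (negPf nbx) (negPf nby) (negPf bA').
rewrite sub0r oppr_eq0 /khom !inE eqxx /= pb setU1K ?inE // /single.
rewrite eqxx (_ : [set x] == [set y] = false) ?sub0r ?mulf_eq0 ?oppr_eq0 ?oner_eq0.
  by rewrite orbF (negPf (ksign_neq0 _ _)).
by apply/negP=> /eqP/set1_inj E; move: xy; rewrite E nonface2_irr.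
Qed.

(** In the complement of [G], the neighbours of [z] form a clique; in [G], the neighbours of [z]
    form a vertex cover of [U]. *)
Definition simplicial (U : {set 'I_n}) z : Prop :=
  forall i j, i \in U -> j \in U -> G i j -> G z i || G z j.

(* Dirac's argument: [C] is a component of the set of non-neighbours of [v],  *)
(* and its neighbourhood [N] is a clique. *)
Lemma simplicial_nonneighbour (U : {set 'I_n}) v w :
  v \in U -> w \in U -> G v w -> exists z, [/\ z \in U, G v z & simplicial U z].
Proof.
have [m] := ubnP #|U|; elim: m U v w => // m IHm U v w /ltnSE Um vU wU vw.
pose A := [set i in U | G v i].
pose e i j := [&& i \in A, j \in A & ~~ G i j].
have e_sym : connect_sym e.
  by apply: sym_connect_sym => i j; rewrite /e nonface2C andbCA.
have wA : w \in A by rewrite inE wU.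
pose C := [set i | connect e w i].
have CA i : i \in C -> i \in A.
  rewrite inE e_sym => /connectP[[|j q] /=]; first by move=> _ <-.
  by case/andP=> /and3P[iA _ _] _ _.
have wC : w \in C by rewrite inE connect0.
pose N := [set i in U :\: C | [exists c in C, ~~ G i c]].
have NP i : reflect [/\ i \in U, i \notin C & exists2 c, c \in C & ~~ G i c] (i \in N).
  rewrite !inE -andbA; apply: (iffP and3P) => -[]; rewrite ?inE.
    by move=> H1 H2 /existsP[c /andP[cC ic]]; split=> //; exists c.
  move=> iU iC [c cC ic]; split=> //; apply/existsP; exists c; exact/andP.
have nNA i : i \in N -> ~~ G v i.
  case/NP=> iU iC [c cC ic]; apply: contra iC => vi.
  have iA : i \in A by rewrite inE iU.
  rewrite inE; apply: connect_trans (connect1 (_ : e c i)); first by rewrite inE in cC.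
  by rewrite /e iA CA //= nonface2C.
have vN : v \notin N.
  by apply/negP=> /NP[_ _ [c /CA]]; rewrite inE => /andP[_ ->].
have vC : v \notin C by apply/negP=> /CA; rewrite inE nonface2_irr andbF.
have Nclique x y : x \in N -> y \in N -> ~~ G x y.
  move=> xN yN; apply/negP=> xy.
  apply: (@no_separating_pair A v x y) => //; try exact: nNA.
  - by apply: contraNneq vN => ->.
  - by apply: contraNneq vN => ->.
  - by move=> i; rewrite inE => /andP[].
  have /NP[_ _ [c cC xc]] := xN; have /NP[_ _ [d dC yd]] := yN.
  have [xB yB] : x \in x |: (y |: A) /\ y \in x |: (y |: A) by rewrite !inE !eqxx orbT.
  have AB i : i \in A -> i \in x |: (y |: A) by move=> iA; rewrite !in_setU1 iA !orbT.
  apply: joined_trans (joined_edge xB (AB _ (CA _ cC)) xc) _.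
  apply: joined_trans (joined_edge (AB _ (CA _ dC)) yB _); last by rewrite nonface2C.
  apply: (joined_connect (e := e)) (AB _ (CA _ cC)) _.
    by move=> i j /and3P[iA jA ij]; split=> //; apply: AB.
  by apply: (connect_trans (y := w)); [rewrite e_sym; rewrite inE in cC | rewrite inE in dC].
have CNU : C :|: N \subset U :\ v.
  apply/subsetP=> i; rewrite in_setU in_setD1 => /orP[iC|iN].
    by have := CA i iC; rewrite inE => /andP[-> _]; rewrite andbT; apply: contraNneq vC => <-.
  by have /NP[-> _ _] := iN; rewrite andbT; apply: contraNneq vN => <-.
have CNm : (#|C :|: N| < m)%N.
  by apply: leq_trans Um; rewrite (cardsD1 v U) vU add1n ltnS subset_leq_card.
(* Every vertex of [U] outside [C :|: N] is joined by [G] to all of [C], so edges leaving [C :|: N]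
   satisfy the condition at [z] automatically. *)
have lift z : z \in C -> simplicial (C :|: N) z ->
    exists z, [/\ z \in U, G v z & simplicial U z].
  move=> zC zS; exists z; have := CA z zC; rewrite inE => /andP[zU vz]; split=> //.
  have zG i : i \in U -> i \notin C :|: N -> G z i.
    rewrite in_setU negb_or => iU /andP[iC]; apply: contraR => zi.
    by apply/NP; split=> //; exists z => //; rewrite nonface2C.
  move=> i j iU jU ij.
  have [iCN|/(zG _ iU)-> //] := boolP (i \in C :|: N).
  have [jCN|/(zG _ jU)->] := boolP (j \in C :|: N); last by rewrite orbT.
  exact: zS.
(* The induction statement asks for [z] with [G x z], which keeps [z] out of the clique [N] when [x]
   lies in [N], hence puts it in [C]. If [N] meets no missing edge, any endpoint of a missing edge
   lies in [C]. *)
have [/existsP[x /existsP[y /and3P[xN yCN xy]]]|noN] :=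
    boolP [exists x, exists y, [&& x \in N, y \in C :|: N & G x y]].
  have [||z [zCN xz zS]] := IHm (C :|: N) x y CNm _ _ xy => //; first by rewrite inE xN orbT.
  apply: lift zS; move: zCN; rewrite inE => /orP[//|zN].
  by move: xz; rewrite (negPf (Nclique x z xN zN)).
have {noN}Nuniv x y : x \in N -> y \in C :|: N -> ~~ G x y.
  move=> xN yCN; apply: contra noN => xy.
  by apply/existsP; exists x; apply/existsP; exists y; apply/and3P.
have [/existsP[x /existsP[y /and3P[xCN yCN xy]]]|noCN] :=
    boolP [exists x, exists y, [&& x \in C :|: N, y \in C :|: N & G x y]].
  have [z [zCN xz zS]] := IHm (C :|: N) x y CNm xCN yCN xy.
  apply: lift zS; move: zCN; rewrite inE => /orP[//|zN].
  by move: xz; rewrite nonface2C (negPf (Nuniv z x zN xCN)).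
apply: lift wC _ => i j iCN jCN ij; case/negP: noCN.
by apply/existsP; exists i; apply/existsP; exists j; apply/and3P.
Qed.

Lemma simplicial_exists (U : {set 'I_n}) : U != set0 ->
  exists2 z, z \in U & simplicial U z.
Proof.
case/set0Pn=> z zU.
have [/existsP[x /existsP[y /and3P[xU yU xy]]]|noG] :=
    boolP [exists x, exists y, [&& x \in U, y \in U & G x y]].
  by have [z' [z'U _ zS]] := simplicial_nonneighbour xU yU xy; exists z'.
exists z => // i j iU jU ij; case/negP: noG.
by apply/existsP; exists i; apply/existsP; exists j; apply/and3P.
Qed.

End Chains.

(** * Monomials and substitutions *)

Section Monomials.
Variables (F : fieldType) (n : nat).
Implicit Types (p q f g h y z : {mpoly F[n]}) (m : 'X_{1..n}) (S T : {set 'I_n}).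

(** An endomorphism of the full ring, so that primes generated by the ['X_i - (x i)%:MP] with [i] in
    [S] are kernels and membership in them is an equation. *)
Definition msubst S (x : 'I_n -> F) p : {mpoly F[n]} :=
  p \mPo [tuple if i \in S then (x i)%:MP else 'X_i | i < n].

HB.instance Definition _ S x :=
  GRing.RMorphism.copy (msubst S x)
    (comp_mpoly [tuple if i \in S then (x i)%:MP else 'X_i | i < n]).

Lemma msubst0 S x : msubst S x 0 = 0.
Proof. exact: rmorph0. Qed.

Lemma msubstD S x : {morph msubst S x : p q / p + q}.
Proof. exact: rmorphD. Qed.

Lemma msubstC S x c : msubst S x c%:MP = c%:MP.
Proof. exact: comp_mpolyC. Qed.

Lemma msubstZ S x c p : msubst S x (c *: p) = c *: msubst S x p.
Proof. exact: comp_mpolyZ. Qed.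

Lemma msubst_var S x i : msubst S x 'X_i = if i \in S then (x i)%:MP else 'X_i.
Proof. by rewrite /msubst comp_mpolyXU -tnth_nth tnth_mktuple. Qed.

Lemma msubst_monomial S x m :
  msubst S x 'X_[m] = \prod_i (if i \in S then (x i)%:MP else 'X_i) ^+ m i.
Proof.
by rewrite /msubst comp_mpolyX; apply: eq_bigr => i _; rewrite tnth_mktuple.
Qed.

Definition avoids S m : bool := [forall i in S, m i == 0%N].

Lemma msubst0_monomial S m : msubst S (fun=> 0) 'X_[m] = (avoids S m)%:R * 'X_[m].
Proof.
rewrite msubst_monomial; have [/forall_inP Sm|] := boolP (avoids S m).
  rewrite mul1r [RHS]mpolyXE_id; apply: eq_bigr => i _.
  by case: ifP => // /Sm/eqP->.
rewrite negb_forall => /existsP[i]; rewrite negb_imply => /andP[iS mi].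
by rewrite (bigD1 i) //= iS mpolyC0 expr0n (negPf mi) !mul0r.
Qed.

Lemma mcoeff_msubst0 S p m : (msubst S (fun=> 0) p)@_m = p@_m *+ avoids S m.
Proof.
rewrite {1}[p]mpolyE rmorph_sum raddf_sum /=.
have E m' : (msubst S (fun=> 0) (p@_m' *: 'X_[m']))@_m
    = (p@_m' *: 'X_[m'])@_m *+ avoids S m.
  rewrite msubstZ msubst0_monomial mulr_natl !mcoeffZ mcoeffMn mcoeffX.
  have [->|] := eqVneq m' m; rewrite ?mulrnAr //= => _.
  by rewrite !mulr0n !mul0rn.
by rewrite (eq_bigr _ (fun m' _ => E m')) sumrMnl -raddf_sum -mpolyE.
Qed.

Lemma msubst0_eq0 S p :
  msubst S (fun=> 0) p = 0 <-> forall m, m \in msupp p -> ~~ avoids S m.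
Proof.
split=> [E m|H].
  rewrite mcoeff_msupp; apply: contra => Sm.
  by have /mpolyP/(_ m) := E; rewrite mcoeff_msubst0 Sm mcoeff0 mulr1n => ->.
apply/mpolyP => m; rewrite mcoeff_msubst0 mcoeff0.
by have [/H/negPf->|/memN_msupp_eq0->] := boolP (m \in msupp p); rewrite ?mul0rn.
Qed.

Lemma mpoly_div_var v p : msubst [set v] (fun=> 0) p = 0 -> exists q, p = 'X_v * q.
Proof.
move=> /msubst0_eq0 H.
exists (\sum_(m <- msupp p) p@_m *: 'X_[m - U_(v)]).
rewrite {1}[p]mpolyE big_distrr /=; rewrite !big_seq; apply: eq_bigr => m /H.
rewrite negb_forall => /existsP[i]; rewrite negb_imply inE => /andP[/eqP-> mv].
by rewrite -scalerAr -mpolyXD addmC submK // lep1mP.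
Qed.

Definition supported (P : 'X_{1..n} -> Prop) p : Prop :=
  forall m, m \in msupp p -> P m.

Lemma supported0 P : supported P 0.
Proof. by move=> m; rewrite msupp0. Qed.

Lemma supportedD P p q : supported P p -> supported P q -> supported P (p + q).
Proof.
by move=> Pp Pq m /msuppD_le; rewrite mem_cat => /orP[/Pp|/Pq].
Qed.

Lemma supportedN P p : supported P p -> supported P (- p).
Proof. by move=> Pp m; rewrite (perm_mem (msuppN p)) => /Pp. Qed.

Lemma supportedM P p q :
  (forall m m', m \in msupp p -> m' \in msupp q -> P (m + m')%MM) ->
  supported P (p * q).
Proof.
by move=> H m /msuppM_le/allpairsP[[m1 m2] [/= m1p m2q ->]]; apply: H.
Qed.

Definition in2 f g h : Prop := exists a b, h = a * f + b * g.

Lemma in2l f g : in2 f g f.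
Proof. by exists 1, 0; ring. Qed.

Lemma in2D f g h1 h2 : in2 f g h1 -> in2 f g h2 -> in2 f g (h1 + h2).
Proof. by move=> [a1 [b1 ->]] [a2 [b2 ->]]; exists (a1 + a2), (b1 + b2); ring. Qed.

Lemma in2M f g c h : in2 f g h -> in2 f g (c * h).
Proof. by move=> [a [b ->]]; exists (c * a), (c * b); ring. Qed.

Lemma in2_congM f g x x' y y' :
  in2 f g (x - x') -> in2 f g (y - y') -> in2 f g (x * y - x' * y').
Proof.
move=> xx' yy'; have -> : x * y - x' * y' = x * (y - y') + y' * (x - x') by ring.
by apply: in2D; apply: in2M.
Qed.

Lemma supported_in2 P f g h : (forall m m', P m' -> P (m + m')%MM) ->
  supported P f -> supported P g -> in2 f g h -> supported P h.
Proof.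
move=> Pup Pf Pg [a [b ->]].
by apply: supportedD; apply: supportedM => m m' _; [move/Pf | move/Pg]; apply: Pup.
Qed.

(* A common monomial in [(f, g)], with no variable dividing both [f] and [g], *)
(* substitutes for coprimality. *)
Lemma koszul_regular f g m y z : in2 f g 'X_[m] ->
  (forall v, msubst [set v] (fun=> 0) f = 0 -> msubst [set v] (fun=> 0) g != 0) ->
  y * f + z * g = 0 -> exists c, y = c * g /\ z = - (c * f).
Proof.
move=> [a [b E]] fg yz.
have {}yz : y * f = - (z * g) by apply/eqP; rewrite -addr_eq0; apply/eqP.
(* Cramer's rule for [yz] and [E]; the determinant [b * y - a * z] should be ['X_[m]] times the
   required cofactor. *)
have H1 : 'X_[m] * y = (b * y - a * z) * g.
  have -> : 'X_[m] * y = a * (y * f) + b * g * y by rewrite E; ring.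
  by rewrite yz; ring.
have H2 : 'X_[m] * z = - ((b * y - a * z) * f).
  have -> : (b * y - a * z) * f = b * (y * f) - a * z * f by ring.
  by rewrite yz E; ring.
move: (b * y - a * z) H1 H2 => c {yz E a b}.
have [d] := ubnP (mdeg m); elim: d m c => // d IHd m c /ltnSE md H1 H2.
have [m0|] := eqVneq (mdeg m) 0%N.
  have {}m0 : m = 0%MM by apply/eqP; rewrite -mdeg_eq0 m0.
  by exists c; move: H1 H2; rewrite m0 mpolyX0 !mul1r.
rewrite mdeg_eq0 => /eqP/mnmP m0.
have [v mv] : exists v, m v != 0%N.
  apply/existsP; apply: contraT => /existsPn H; case: m0 => v.
  by rewrite mnm0E; have := H v; rewrite negbK => /eqP.
pose m' := (m - U_(v))%MM; have mE : 'X_[m] = 'X_v * 'X_[m'] :> {mpoly F[n]}.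
  by rewrite -mpolyXD addmC submK // lep1mP.
have md' : (mdeg m' < d)%N.
  move: md; have -> : m = (m' + U_(v))%MM by rewrite submK // lep1mP.
  by rewrite mdegD mdeg1 addn1.
pose r p := msubst [set v] (fun=> 0) p.
have rv : r 'X_v = 0 by rewrite /r msubst_var inE eqxx mpolyC0.
have rM : {morph r : p q / p * q} by exact: rmorphM.
have rN : {morph r : p / - p} by exact: rmorphN.
(* Modulo ['X_v] both [c * f] and [c * g] vanish while one of [f], [g] does not, so ['X_v] divides
   [c] and cancels from both relations. *)
have rc : r c = 0.
  have := congr1 r H1; have := congr1 r H2.
  rewrite mE rN !rM rv !mul0r => /esym/eqP.
  rewrite oppr_eq0 mulf_eq0 => /orP[/eqP //|/eqP/fg gv] /esym/eqP.
  by rewrite mulf_eq0 (negPf gv) orbF => /eqP.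
have [c' cE] := mpoly_div_var rc.
have vX : 'X_v != 0 :> {mpoly F[n]}.
  by apply: contraTneq isT => /mpolyP/(_ U_(v)%MM)/eqP; rewrite mcoeffXU eqxx mcoeff0 oner_eq0.
apply: (IHd m' c' md'); apply: (mulfI vX).
  by rewrite mulrA -mE H1 cE mulrA.
by rewrite mulrA -mE H2 cE mulrN mulrA.
Qed.

Lemma pihomogM d D a f : f \is d.-homog ->
  pihomog mdeg D (a * f) = if (d <= D)%N then pihomog mdeg (D - d) a * f else 0.
Proof.
move=> df; have E m : pihomog mdeg D ('X_[m] * f) =
    if (d <= D)%N && (mdeg m == D - d)%N then 'X_[m] * f else 0.
  have dX : 'X_[m] * f \is (mdeg m + d).-homog by apply: dhomogM; rewrite ?dhomogX.
  have -> : (d <= D)%N && (mdeg m == D - d)%N = (mdeg m + d == D)%N.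
    by have [dD|dD] := leqP d D; apply/idP/idP; lia.
  by have [<-|/pihomog_ne0->//] := eqVneq; rewrite ?pihomog_dE.
rewrite {1}[a]mpolyE big_distrl raddf_sum /= pihomogE.
transitivity (\sum_(m <- msupp a) a@_m *:
    if (d <= D)%N && (mdeg m == D - d)%N then 'X_[m] * f else 0).
  by apply: eq_bigr => m _; rewrite -E -scalerAl linearZ.
case: ifP => _ /=; last by rewrite big1 // => m _; rewrite scaler0.
rewrite big_distrl [RHS]big_mkcond /=; apply: eq_bigr => m _.
by case: ifP; rewrite ?scaler0 // scalerAl.
Qed.

Lemma dhomog_in2 d1 d2 D f g h : f \is d1.-homog -> g \is d2.-homog ->
  h \is D.-homog -> in2 f g h -> (d1 <= D)%N -> (d2 <= D)%N ->
  exists a b, [/\ a \is (D - d1).-homog, b \is (D - d2).-homog & h = a * f + b * g].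
Proof.
move=> df dg dh [a [b E]] d1D d2D.
exists (pihomog mdeg (D - d1) a), (pihomog mdeg (D - d2) b).
split; rewrite ?pihomogP //.
by rewrite -(pihomog_dE dh) E raddfD /= (pihomogM _ _ df) (pihomogM _ _ dg) d1D d2D.
Qed.

Definition sqfree T : {mpoly F[n]} := 'X_[mesym1 T].

Lemma sqfree_homog T : sqfree T \is #|T|.-homog.
Proof. by rewrite dhomogX /= mdeg_mesym1. Qed.

Lemma sqfreeE S T : S \subset T -> sqfree T = sqfree S * sqfree (T :\: S).
Proof.
move=> ST; rewrite -mpolyXD; congr 'X_[_]; apply/mnmP=> i.
rewrite mnmDE !mnmE !inE; have [iS|] := boolP (i \in S); last by [].
by rewrite (subsetP ST).
Qed.

Lemma sqfree1 i : sqfree [set i] = 'X_i.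
Proof. by rewrite /sqfree mesym1_set1. Qed.

End Monomials.

(** * Cover ideals generated up to radical by two forms *)

Section Covers.
Variables (F : fieldType) (n : nat) (G : rel 'I_n).
Implicit Types (T U : {set 'I_n}) (m : 'X_{1..n}) (f g : {mpoly F[n]}).

Definition msup m : {set 'I_n} := [set i | m i != 0%N].

Definition covers U T : Prop :=
  forall i j, i \in U -> j \in U -> G i j -> i \in T \/ j \in T.

Definition mcovers U m : Prop := covers U (msup m).

Lemma mcovers_up U m m' : mcovers U m' -> mcovers U (m + m')%MM.
Proof.
have sub i : i \in msup m' -> i \in msup (m + m')%MM.
  by rewrite !inE mnmDE addn_eq0 negb_and orbC => ->.
by move=> H i j iU jU /(H i j iU jU)[/sub|/sub]; [left | right].
Qed.

Hypothesis G_sym : forall i j, G i j = G j i.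
Hypothesis G_irr : irreflexive G.
Hypothesis G_elim : forall U, U != set0 ->
  exists2 z, z \in U & forall i j, i \in U -> j \in U -> G i j -> G z i || G z j.

(* Adding a simplicial vertex [z] with neighbour monomial [u] replaces the    *)
(* cover ideal [J] by [x_z J + (u)].  If [f, g] define [J] up to radical and  *)
(* [u^N = a f + b g], then [x_z^p f - b u] and [x_z^p g + a u] define         *)
(* [x_z J + (u)] up to radical. *)
Lemma cover_ideal_stci U : exists f g d1 d2,
  [/\ f \is d1.-homog, g \is d2.-homog, supported (mcovers U) f,
      supported (mcovers U) g
    & forall T, covers U T -> exists N, in2 f g (sqfree F T ^+ N)].
Proof.
have [c] := ubnP #|U|; elim: c U => // c IHc U /ltnSE Uc.
have [->|/G_elim[z zU zs]] := eqVneq U set0.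
  exists 1, 0, 0%N, 0%N; split; rewrite ?dhomog1 ?dhomog0 //.
  - by move=> m _ i j; rewrite inE.
  - exact: supported0.
  by move=> T _; exists 0%N; apply: in2l.
have [|f [g [d1 [d2 [df dg fU gU fgU]]]]] := IHc (U :\ z).
  by move: Uc; rewrite (cardsD1 z U) zU.
pose Nz := [set w in U | G z w].
have zNz : z \notin Nz by rewrite inE G_irr andbF.
have covD1 T : covers U T -> covers (U :\ z) T.
  by move=> H i j /setD1P[_ iU] /setD1P[_ jU]; apply: H.
have [Nz0|Nz0] := eqVneq Nz set0.
  have covU T : covers (U :\ z) T -> covers U T.
    move=> H i j iU jU ij.
    have nz k : k \in U -> G z k -> False.
      move=> kU zk; have : k \in Nz by rewrite inE kU.
      by rewrite Nz0 inE.
    apply: H => //; rewrite !inE ?iU ?jU andbT.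
      by apply/eqP=> iz; apply: (nz j jU); rewrite -iz.
    by apply/eqP=> jz; apply: (nz i iU); rewrite -jz G_sym.
  exists f, g, d1, d2; split=> // [m /fU/covU|m /gU/covU|T /covD1/fgU] //.
have covNz : covers U Nz.
  by move=> i j iU jU /(zs i j iU jU)/orP[]H; [left | right]; rewrite inE ?iU ?jU.
set e := #|Nz|; have e0 : (0 < e)%N by rewrite card_gt0.
pose u := sqfree F Nz; have [N0 uN0] := fgU Nz (covD1 _ covNz).
(* The padding gives [d1 + d2 <= e * N], which keeps the truncated subtractions exact. *)
pose N := (N0 + (d1 + d2))%N.
have uN : in2 f g (u ^+ N) by rewrite /N addnC exprD; apply: in2M.
have duN : u ^+ N \is (e * N).-homog by apply/dhomogMn/sqfree_homog.
have NeN : (N <= e * N)%N by rewrite leq_pmull.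
have d1N : (d1 <= e * N)%N by apply: leq_trans NeN; rewrite /N addnCA leq_addr.
have d2N : (d2 <= e * N)%N by apply: leq_trans NeN; rewrite /N addnA leq_addl.
have [a [b [da db E]]] := dhomog_in2 df dg duN uN d1N d2N.
(* Chosen so that ['X_z ^+ p * f] has the degree of [b * u] and ['X_z ^+ p * g] that of [a * u];
   positive because [e] is. *)
pose p := (e * N + e - d1 - d2)%N.
have [p0 pd1 pd2] : [/\ (0 < p)%N, (p + d1 = e * N - d2 + e)%N
    & (p + d2 = e * N - d1 + e)%N].
  have : (d1 + d2 <= e * N)%N by apply: leq_trans NeN; apply: leq_addl.
  rewrite /p; move: (e * N)%N d1N d2N e0; clearbody e; clear.
  by move=> x; split; lia.
have du : u \is e.-homog by apply: sqfree_homog.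
pose F1 : {mpoly F[n]} := 'X_z ^+ p * f - b * u; pose F2 : {mpoly F[n]} := 'X_z ^+ p * g + a * u.
have Xp : ('X_z : {mpoly F[n]}) ^+ p \is p.-homog.
  have X1 : ('X_z : {mpoly F[n]}) \is 1.-homog by rewrite dhomogX /= mdeg1.
  by have := dhomogMn p X1; rewrite mul1n.
have covX (h : {mpoly F[n]}) :
    supported (mcovers (U :\ z)) h -> supported (mcovers U) ('X_z ^+ p * h).
  move=> hU; apply: supportedM => m m'; rewrite mpolyXn => /mem_msuppXP <- /hU m'U.
  have zm : z \in msup (U_(z) *+ p + m')%MM.
    by rewrite inE mnmDE mulmnE mnm1E eqxx mul1n addn_eq0 negb_and -lt0n p0.
  move=> i j iU jU ij; have [->|iz] := eqVneq i z; first by left.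
  have [->|jz] := eqVneq j z; first by right.
  by apply: (mcovers_up _ m'U) => //; rewrite !inE ?iz ?jz.
have covu (h : {mpoly F[n]}) : supported (mcovers U) (h * u).
  apply: supportedM => m m' _ /mem_msuppXP <-; apply: mcovers_up.
  rewrite /mcovers (_ : msup _ = Nz) //.
  by apply/setP=> i; rewrite inE mnmE; case: (i \in Nz).
exists F1, F2, (p + d1)%N, (p + d2)%N; split.
- by apply: rpredB; [apply: dhomogM | rewrite pd1; apply: dhomogM].
- by apply: rpredD; [apply: dhomogM | rewrite pd2; apply: dhomogM].
- by rewrite /F1; apply: supportedD; [exact: covX | apply: supportedN; exact: covu].
- by rewrite /F2; apply: supportedD; [exact: covX | exact: covu].
move=> T TU.
have F12 : in2 F1 F2 ('X_z ^+ p * u ^+ N).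
  by exists a, b; rewrite E /F1 /F2; ring.
have [zT|zT] := boolP (z \in T); last first.
  (* A cover without [z] contains [Nz], and [f * F2 - g * F1 = u ^+ N.+1]. *)
  have NT : Nz \subset T.
    apply/subsetP=> w; rewrite inE => /andP[wU zw].
    by have [zT'|//] := TU z w zU wU zw; rewrite zT' in zT.
  exists N.+1; rewrite (sqfreeE F NT) exprMn mulrC; apply: in2M.
  by exists (- g), f; rewrite exprSr E /F1 /F2 -/u; ring.
have [M [al [be TM]]] := fgU T (covD1 _ TU).
(* Modulo [(F1, F2)], ['X_z ^+ p * sqfree F T ^+ M] is congruent to [(al * b - be * a) * u]; the
   [N]-th power of the latter, times ['X_z ^+ p], is a multiple of the element in [F12]. *)
have EN : in2 F1 F2 (('X_z ^+ p * sqfree F T ^+ M) ^+ N * 'X_z ^+ p).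
  rewrite -[_ ^+ N](subrK (((al * b - be * a) * u) ^+ N)) mulrDl; apply: in2D.
    rewrite subrXX mulrAC -mulrA mulrC; apply: in2M.
    by exists al, be; rewrite TM /F1 /F2; ring.
  by rewrite exprMn -mulrA [u ^+ N * _]mulrC; apply: in2M.
exists (M * N + p * N.+1)%N.
have -> : sqfree F T ^+ (M * N + p * N.+1) = sqfree F (T :\ z) ^+ (p * N.+1) *
    (('X_z ^+ p * sqfree F T ^+ M) ^+ N * 'X_z ^+ p).
  rewrite exprD [X in _ * X ^+ _](@sqfreeE F _ [set z]) ?sub1set // sqfree1.
  by rewrite !exprMn -!exprM mulnS !exprD; ring.
exact: in2M.
Qed.
End Covers.

(** * Leading forms after subtracting constants from two forms *)

Section LeadingForms.
Variables (F : fieldType) (n : nat).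
Implicit Types (p a b c h : {mpoly F[n]}) (m : 'X_{1..n}).

Lemma mcoeff_pihomog d p m : (pihomog mdeg d p)@_m = p@_m *+ (mdeg m == d).
Proof.
rewrite {2}[p]mpolyE pihomogE !raddf_sum /= -sumrMnl [LHS]big_mkcond /=.
apply: eq_bigr => m' _; rewrite mcoeffZ mcoeffX.
have [->|mm] := eqVneq m' m; first by case: ifP; rewrite ?mulr1n ?mulr0n.
by rewrite mulr0 mul0rn; case: ifP.
Qed.

Variables (f g : {mpoly F[n]}) (d1 d2 : nat) (s t : F) (P : 'X_{1..n} -> Prop).
Hypotheses (df : f \is d1.-homog) (dg : g \is d2.-homog).
Hypotheses (d1_gt0 : (0 < d1)%N) (d2_gt0 : (0 < d2)%N).
Hypothesis fg_regular : forall y z, y * f + z * g = 0 ->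
  exists c, y = c * g /\ z = - (c * f).
Hypotheses (P_up : forall m m', P m' -> P (m + m')%MM)
  (Pf : supported P f) (Pg : supported P g).

(** The bound [N - e] on the degree, written without subtraction so that [N < e] forces [p = 0]. *)
Definition deg_le e N p : Prop := forall m, m \in msupp p -> (mdeg m + e <= N)%N.

Lemma deg_leM e N a q : q \is e.-homog -> deg_le e N a -> deg_le 0 N (a * q).
Proof.
move=> /dhomogP qe aN; apply: supportedM => m m' /aN mN /qe /= E.
by rewrite mdegD addn0 E.
Qed.

Lemma deg_leW e N p : deg_le e N p -> deg_le 0 N p.
Proof. by move=> pN m /pN; rewrite addn0; apply: leq_trans; apply: leq_addr. Qed.

Lemma deg_leB N p q : deg_le 0 N p -> deg_le 0 N q -> deg_le 0 N (p - q).
Proof. by move=> pN qN m /msuppB_le; rewrite mem_cat => /orP[/pN|/qN]. Qed.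

Lemma deg_leZ e N x p : deg_le e N p -> deg_le e N (x *: p).
Proof. by move=> pN m /msuppZ_le/pN. Qed.

(* The component of [a] that contributes to degree [N] of [a * q], when [q]   *)
(* is homogeneous of degree [e]; truncated subtraction is excluded. *)
Definition top_part e N a := if (e <= N)%N then pihomog mdeg (N - e) a else 0.

Lemma pihomog_top e N q x a : q \is e.-homog -> (0 < e)%N -> deg_le e N a ->
  pihomog mdeg N (a * (q - x%:MP)) = top_part e N a * q.
Proof.
move=> qe e0 aN; rewrite mulrBr raddfB /= (pihomogM _ _ qe) /top_part.
have -> : pihomog mdeg N (a * x%:MP) = 0.
  apply/mpolyP => m; rewrite mcoeff_pihomog mulrC mul_mpolyC mcoeffZ mcoeff0.
  have [/aN mN|/memN_msupp_eq0->] := boolP (m \in msupp a); last by rewrite mulr0 mul0rn.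
  by case: eqP => [mE|_]; [lia | rewrite mulr0n].
by rewrite subr0; case: ifP; rewrite ?mul0r.
Qed.

Lemma deg_le_top e N a : deg_le e N.+1 a -> deg_le e N (a - top_part e N.+1 a).
Proof.
move=> aN m; rewrite mcoeff_msupp mcoeffB => am.
have ma : m \in msupp a.
  rewrite mcoeff_msupp; apply: contraNneq am => a0.
  by rewrite a0 /top_part; case: ifP; rewrite ?mcoeff_pihomog ?mcoeff0 ?a0 ?mul0rn subr0.
have := aN m ma; rewrite leq_eqVlt => /orP[/eqP mE|]; last by rewrite ltnS.
move: am; rewrite /top_part -mE leq_addl addnK mcoeff_pihomog eqxx mulr1n subrr.
by rewrite eqxx.
Qed.

Lemma top_partM e e' N a c q : q \is e'.-homog -> deg_le e N a ->
  top_part e N a = c * q ->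
  top_part e N a = top_part (e + e') N c * q.
Proof.
move=> qe' aN E; have := congr1 (pihomog mdeg (N - e)) E.
rewrite (pihomogM _ _ qe') /top_part; have [eN|Ne] := leqP e N; last first.
  by rewrite [(e + e' <= N)%N]leqNgt (leq_trans Ne (leq_addr _ _)) mul0r.
rewrite pihomog_id => ->; rewrite leq_subRL // subnDA.
by case: ifP; rewrite ?mul0r.
Qed.

Lemma top_part_deg e N c : deg_le e N (top_part e N c).
Proof.
rewrite /top_part; case: ifP => eN m; last by rewrite msupp0.
rewrite mcoeff_msupp mcoeff_pihomog.
by have [->|_] := eqVneq (mdeg m) (N - e)%N; rewrite ?subnK // mulr0n eqxx.
Qed.

(* If the leading forms of [a (f - s)] and [b (g - t)] cancel, then           *)
(* regularity lets [(a, b)] be lowered by a multiple of [(g - t, s - f)]. *)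
Lemma leading_form h m : in2 (f - s%:MP) (g - t%:MP) h -> m \in msupp h ->
  (forall m', m' \in msupp h -> (mdeg m' <= mdeg m)%N) -> P m.
Proof.
move=> [a [b hE]] mh mmax.
have [N [aN bN]] : exists N, deg_le d1 N a /\ deg_le d2 N b.
  exists (msize a + d1 + (msize b + d2))%N; split=> m' /msize_mdeg_lt; lia.
elim: N a b hE aN bN => [|N IHN] a b hE aN bN.
  have a0 : a = 0.
    apply/eqP; rewrite -msupp_eq0; apply/eqP; case E : (msupp a) => [//|m' l].
    by have := aN m'; rewrite E mem_head => /(_ isT); lia.
  have b0 : b = 0.
    apply/eqP; rewrite -msupp_eq0; apply/eqP; case E : (msupp b) => [//|m' l].
    by have := bN m'; rewrite E mem_head => /(_ isT); lia.
  by move: mh; rewrite hE a0 b0 !mul0r addr0 msupp0.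
have topE : pihomog mdeg N.+1 h = top_part d1 N.+1 a * f + top_part d2 N.+1 b * g.
  by rewrite hE raddfD /= (pihomog_top _ df) // (pihomog_top _ dg).
have hN : (mdeg m <= N.+1)%N.
  have dC q e x c : q \is e.-homog -> deg_le e N.+1 c -> deg_le 0 N.+1 (c * (q - x%:MP)).
    move=> qe cN; rewrite mulrBr mulrC (mulrC c) mul_mpolyC; apply: deg_leB.
      by rewrite mulrC; apply: deg_leM qe cN.
    by apply/deg_leZ/deg_leW/cN.
  move: mh; rewrite hE => /msuppD_le; rewrite mem_cat => /orP[].
    by move/(dC _ _ _ _ df aN); rewrite addn0.
  by move/(dC _ _ _ _ dg bN); rewrite addn0.
move: hN; rewrite leq_eqVlt => /orP[/eqP mN|mN].
  apply: (supported_in2 P_up Pf Pg (h := pihomog mdeg N.+1 h)).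
    by exists (top_part d1 N.+1 a), (top_part d2 N.+1 b).
  by rewrite mcoeff_msupp mcoeff_pihomog mN eqxx mulr1n -mcoeff_msupp.
have : pihomog mdeg N.+1 h = 0.
  apply/mpolyP => m'; rewrite mcoeff_pihomog mcoeff0.
  have [/mmax m'm|/memN_msupp_eq0->] := boolP (m' \in msupp h); last by rewrite mul0rn.
  by case: eqP => [m'N|_]; [lia | rewrite mulr0n].
rewrite topE => /fg_regular[c [ca cb]].
(* Only the component of [c] in the matching degree takes part in the cancellation. The remainder
   [t *: c'] has degree at most [N.+1 - d1 - d2], so [0 < d2] lowers the bound on [a]; likewise
   [0 < d1] for [b]. *)
pose c' := top_part (d1 + d2) N.+1 c.
have {}ca : top_part d1 N.+1 a = c' * g by apply: top_partM dg aN ca.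
have {}cb : top_part d2 N.+1 b = - c' * f.
  rewrite -mulNr in cb; rewrite (top_partM df bN cb) addnC /c' /top_part.
  by case: ifP; rewrite ?raddfN ?oppr0.
have c'N : deg_le (d1 + d2) N.+1 c' by apply: top_part_deg.
apply: (IHN (a - c' * (g - t%:MP)) (b + c' * (f - s%:MP))).
- by rewrite hE; ring.
- have -> : a - c' * (g - t%:MP) = t *: c' + (a - top_part d1 N.+1 a).
    by rewrite ca -mul_mpolyC; ring.
  move=> m' /msuppD_le; rewrite mem_cat => /orP[/msuppZ_le/c'N|/(deg_le_top aN) //]; lia.
have -> : b + c' * (f - s%:MP) = (- s) *: c' + (b - top_part d2 N.+1 b).
  by rewrite cb scaleNr -mul_mpolyC; ring.
move=> m' /msuppD_le; rewrite mem_cat => /orP[/msuppZ_le/c'N|/(deg_le_top bN) //]; lia.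
Qed.
End LeadingForms.

(** * Fibres over the generic point *)

Lemma fraction_denom (B : idomainType) (x : {fraction B}) :
  exists a b : B, b != 0 /\ FracField.tofrac b * x = FracField.tofrac a.
Proof.
elim/quotW: x => r; exists (frac r).1, (frac r).2; split; first exact: denom_ratioP.
unlock FracField.tofrac; rewrite -[LHS]FracField.pi_mul; apply/eqP.
rewrite FracField.equivf_def /FracField.mulf !numden_Ratio ?mulf_neq0 ?oner_eq0 ?denom_ratioP //.
by rewrite !mulr1 !mul1r mulrC.
Qed.

Section MkPrime.
Variables (R : comNzRingType) (S : R -> Prop).
Hypotheses (S0 : S 0) (SD : forall x y, S x -> S y -> S (x + y))
  (SM : forall a x, S x -> S (a * x)) (S1 : ~ S 1).

Definition ideal_pred (x : R) : bool := `[< S x >].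

Lemma ideal_pred_closed : idealr_closed ideal_pred.
Proof.
split; first exact/asboolP; first exact/asboolPn.
by move=> a x y /asboolP Sx /asboolP Sy; apply/asboolP/SD => //; apply: SM.
Qed.

Hypothesis Sprime : forall x y, S (x * y) -> S x \/ S y.

Lemma ideal_pred_prime : prime_idealr_closed ideal_pred.
Proof.
move=> x y /asboolP/Sprime[Sx|Sy]; apply/orP; [left|right]; exact/asboolP.
Qed.

Lemma prime_of_closed : exists J : prime_idealr R, forall x, x \in J <-> S x.
Proof.
pose H := isIdealr.Build R ideal_pred ideal_pred_closed.
pose H' := isPrimeIdealrClosed.Build R ideal_pred ideal_pred_prime.
pose J : prime_idealr R := HB.pack ideal_pred H H'.
exists J => x.
rewrite unfold_in; split; [move/asboolP | move=> ?; apply/asboolP] => //.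
Qed.
End MkPrime.

Section GenericFibre.
Variables (k : fieldType) (n : nat) (B : idomainType).
Variables (c0 : {rmorphism k -> B}) (sigma : {rmorphism B -> {mpoly k[n]}}).
Hypothesis sigma_c0 : forall a, sigma (c0 a) = a%:MP.
Hypothesis sigma_inj : forall b, sigma b = 0 -> b = 0.

Variables (K : fieldType) (tofrac : {rmorphism B -> K}).
Hypothesis tofrac_inj : injective tofrac.
Hypothesis tofrac_denom : forall x, exists a b, b != 0 /\ tofrac b * x = tofrac a.

Let iota : {rmorphism k -> K} := tofrac \o c0.

Definition gen_eval (H : {mpoly B[n]}) : {mpoly k[n]} := mmap sigma (fun i => 'X_i) H.

HB.instance Definition _ := GRing.RMorphism.copy gen_eval (mmap sigma (fun i => 'X_i)).

Lemma clear_denominators (h : {mpoly K[n]}) :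
  exists (b : B) (H : {mpoly B[n]}), b != 0 /\ tofrac b *: h = map_mpoly tofrac H.
Proof.
elim/mpolyind: h => [|x m h _ _ [b [H [b0 E]]]].
  by exists 1, 0; rewrite oner_eq0 scaler0 rmorph0.
have [a [d [d0 xE]]] := tofrac_denom x.
exists (d * b), ((b * a) *: 'X_[m] + d *: H); rewrite mulf_neq0 //; split=> //.
rewrite rmorphD /= !map_mpolyZ /= map_mpolyX -E scalerDr !scalerA -!rmorphM /=.
by congr (_ *: _ + _); rewrite !rmorphM -xE /=; ring.
Qed.

(* The ideal of the generic fibre of [Spec k[x] -> Spec B]. *)
Definition generic_ideal (h : {mpoly K[n]}) : Prop :=
  exists (b : B) (H : {mpoly B[n]}),
    [/\ b != 0, tofrac b *: h = map_mpoly tofrac H & gen_eval H = 0].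

Lemma gen_evalC b : gen_eval b%:MP = sigma b.
Proof. exact: mmapC. Qed.

Lemma gen_evalZ b H : gen_eval (b *: H) = sigma b * gen_eval H.
Proof. by rewrite -mul_mpolyC rmorphM /= gen_evalC. Qed.

Lemma map_tofrac_inj : injective (map_mpoly (n := n) tofrac).
Proof.
move=> p q /mpolyP E; apply/mpolyP => m; have := E m.
by rewrite !mcoeff_map_mpoly => /tofrac_inj.
Qed.

(** The ideal is the kernel of the map from [K[x]] to the localisation of [k[x]] at the nonzero
    elements of [sigma B], a domain; injectivity of [sigma] keeps denominators nonzero. *)
Lemma generic_prime_exists :
  exists P : prime_idealr {mpoly K[n]}, forall h, h \in P <-> generic_ideal h.
Proof.
apply: prime_of_closed.
- by exists 1, 0; rewrite oner_eq0 scaler0 !rmorph0.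
- move=> x y [b1 [H1 [b10 E1 Z1]]] [b2 [H2 [b20 E2 Z2]]].
  exists (b1 * b2), (b2 *: H1 + b1 *: H2); split; first by rewrite mulf_neq0.
    rewrite rmorphD /= !map_mpolyZ /= -E1 -E2 scalerDr !scalerA -!rmorphM /=.
    by rewrite (mulrC b2).
  by rewrite rmorphD /= !gen_evalZ Z1 Z2 !mulr0 addr0.
- move=> x y [b2 [H2 [b20 E2 Z2]]]; have [b1 [H1 [b10 E1]]] := clear_denominators x.
  exists (b1 * b2), (H1 * H2); split; first by rewrite mulf_neq0.
    by rewrite !rmorphM /= -E1 -E2 -scalerAl -scalerAr scalerA.
  by rewrite rmorphM /= Z2 mulr0.
- move=> [b [H [b0 E Z]]]; case/eqP: b0; apply: sigma_inj; rewrite -gen_evalC -Z.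
  congr gen_eval; apply: map_tofrac_inj.
  by rewrite -E map_mpolyC -mul_mpolyC mulr1.
move=> x y [b [H [b0 E Z]]].
have [b1 [H1 [b10 E1]]] := clear_denominators x.
have [b2 [H2 [b20 E2]]] := clear_denominators y.
have : b *: (H1 * H2) = (b1 * b2) *: H.
  apply: map_tofrac_inj; rewrite !map_mpolyZ /= !rmorphM /= -E1 -E2 -E.
  by rewrite -scalerAl -scalerAr !scalerA; congr (_ *: _); ring.
move/(congr1 gen_eval); rewrite !gen_evalZ Z mulr0 rmorphM /= => /eqP.
rewrite mulf_eq0 => /orP[/eqP/sigma_inj/eqP|]; first by rewrite (negPf b0).
by rewrite mulf_eq0 => /orP[/eqP Z1|/eqP Z2]; [left; exists b1, H1 | right; exists b2, H2].
Qed.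

Variables (f g : {mpoly k[n]}) (s t : B).
Hypothesis sigma_s : sigma s = f.
Hypothesis sigma_t : sigma t = g.
Let fK : {mpoly K[n]} := map_mpoly iota f - (tofrac s)%:MP.
Let gK : {mpoly K[n]} := map_mpoly iota g - (tofrac t)%:MP.
Hypothesis B_gen : forall b, in2 fK gK ((tofrac b)%:MP - map_mpoly iota (sigma b)).

Lemma gen_eval_map h : gen_eval (map_mpoly c0 h) = h.
Proof.
elim/mpolyind: h => [|a m h _ _ IH]; first by rewrite !rmorph0.
rewrite !rmorphD /= IH map_mpolyZ /= map_mpolyX gen_evalZ sigma_c0 mul_mpolyC.
by rewrite /gen_eval mmapX mmap1_id.
Qed.

Lemma generic_ideal_gens : generic_ideal fK /\ generic_ideal gK.
Proof.
have gen h b : sigma b = h -> generic_ideal (map_mpoly iota h - (tofrac b)%:MP).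
  move=> hb; exists 1, (map_mpoly c0 h - b%:MP); split; rewrite ?oner_eq0 //.
    rewrite rmorph1 scale1r rmorphB /= map_mpolyC; congr (_ - _).
    by apply/mpolyP => m; rewrite !mcoeff_map_mpoly.
  rewrite rmorphB /= gen_evalC hb; apply/eqP; rewrite subr_eq0; apply/eqP.
  exact: gen_eval_map.
by split; apply: gen.
Qed.

(** Modulo [fK] and [gK] a scalar of [B] equals its image under [sigma]. Hence the kernel of
    [gen_eval] lands in [(fK, gK)], and inverting denominators yields [generic_idealP]. *)
Lemma in2_gen_eval (H : {mpoly B[n]}) :
  in2 fK gK (map_mpoly tofrac H - map_mpoly iota (gen_eval H)).
Proof.
elim/mpolyind: H => [|b m H _ _ IH].
  by exists 0, 0; rewrite !rmorph0; ring.
have -> : gen_eval (b *: 'X_[m] + H) = sigma b * 'X_[m] + gen_eval H.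
  by rewrite rmorphD /= gen_evalZ /gen_eval mmapX mmap1_id.
rewrite (rmorphD (map_mpoly tofrac)) (rmorphD (map_mpoly iota)).
rewrite (rmorphM (map_mpoly iota)) /= map_mpolyZ !map_mpolyX opprD addrACA.
apply: in2D => //.
by rewrite -mul_mpolyC -mulrBl mulrC; apply: in2M; apply: B_gen.
Qed.

Lemma generic_idealP h : generic_ideal h -> in2 fK gK h.
Proof.
move=> [b [H [b0 E Z]]]; have := in2_gen_eval H; rewrite Z -E rmorph0 subr0.
have b0' : tofrac b != 0 by rewrite -(rmorph0 tofrac) (inj_eq tofrac_inj).
move=> /(in2M ((tofrac b)^-1)%:MP).
by rewrite mul_mpolyC scalerA mulVf // scale1r.
Qed.

End GenericFibre.

(** * Primes of polynomial rings and their quotients *)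

Section PrimeChains.
Variables (k : fieldType) (n : nat).
Local Notation R := {mpoly k[n]}.
Implicit Types (f : R) (S T W : {set 'I_n}) (x : 'I_n -> k) (m : 'X_{1..n}).

Lemma mpolyX_neq0 m : 'X_[m] != 0 :> R.
Proof.
by apply: contraTneq isT => /mpolyP/(_ m)/eqP; rewrite mcoeffX eqxx mcoeff0 oner_eq0.
Qed.

Lemma subst_prime_exists S x :
  exists P : prime_idealr R, forall f, f \in P <-> msubst S x f = 0.
Proof.
apply: prime_of_closed => [|f g Sf Sg|f g Sg||f g].
- exact: rmorph0.
- by rewrite rmorphD /= Sf Sg addr0.
- by rewrite rmorphM /= Sg mulr0.
- by rewrite rmorph1 => /eqP; rewrite oner_eq0.
by rewrite rmorphM /= => /eqP; rewrite mulf_eq0 => /orP[]/eqP; [left|right].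
Qed.

Lemma msubst_comp S T x f : S \subset T -> msubst T x (msubst S x f) = msubst T x f.
Proof.
move=> ST; elim/mpolyind: f => [|c m f _ _ IH]; first by rewrite !rmorph0.
rewrite !msubstD IH !msubstZ.
suff -> : msubst T x (msubst S x 'X_[m]) = msubst T x 'X_[m] by [].
rewrite [msubst S x _]msubst_monomial rmorph_prod msubst_monomial.
apply: eq_bigr => i _; rewrite rmorphXn /=; congr (_ ^+ _).
have [iS|iS] := boolP (i \in S); last by rewrite msubst_var.
by rewrite (subsetP ST) // msubstC.
Qed.

Lemma msubst_sub S T x f : S \subset T -> msubst S x f = 0 -> msubst T x f = 0.
Proof. by move=> ST Sf; rewrite -(msubst_comp x f ST) Sf rmorph0. Qed.

Lemma msubst_setT x f : msubst setT x f = (f.@[x])%:MP.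
Proof.
elim/mpolyind: f => [|c m f _ _ IH]; first by rewrite !rmorph0.
rewrite msubstD mevalD IH msubstZ mevalZ mpolyCD mpolyCM mul_mpolyC.
suff -> : msubst setT x 'X_[m] = ('X_[m].@[x])%:MP by [].
rewrite msubst_monomial mevalX rmorph_prod; apply: eq_bigr => i _.
by rewrite inE rmorphXn.
Qed.

Lemma msubst_var_sub S x i :
  msubst S x ('X_i - (x i)%:MP) = if i \in S then 0 else 'X_i - (x i)%:MP.
Proof. by rewrite rmorphB /= msubstC msubst_var; case: ifP; rewrite ?subrr. Qed.

Lemma var_sub_neq0 i (a : k) : 'X_i - a%:MP != 0 :> R.
Proof.
rewrite subr_eq0; apply: contraTneq isT => /mpolyP/(_ U_(i)%MM)/eqP.
by rewrite mcoeffXU eqxx mcoeffC mnm1_eq0 mulr0 oner_eq0.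
Qed.

Lemma prime_monomial (P : prime_idealr R) m :
  'X_[m] \in P -> exists2 i, m i != 0%N & 'X_i \in P.
Proof.
move=> mP; suff /existsP[i /andP[mi iP]] : [exists i, (m i != 0%N) && ('X_i \in P)].
  by exists i.
apply: contraLR mP => /existsPn H.
rewrite mpolyXE_id; apply: (big_ind (fun f => f \notin P)) => [|f g fP gP|i _].
- by rewrite idealr1.
- by rewrite prime_idealrM negb_or fP.
have := H i; rewrite negb_and negbK => /orP[/eqP->|iP]; first by rewrite idealr1.
elim: (m i) => [|d IHd]; first by rewrite idealr1.
by rewrite exprS prime_idealrM negb_or iP.
Qed.

Lemma prime_codim0 (P : prime_idealr R) :
  (forall f, f \in P -> f = 0) -> prime_codim P 0.
Proof.
move=> P0; split.
  exists (fun=> P); split=> // i j; by rewrite !ord1.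
case=> // m [q [qP qlt]].
have [_ []] := qlt ord0 ord_max isT.
by move=> f; rewrite qP => /P0->; apply: rpred0.
Qed.

(** A prime strictly inside [('X_i)] does not contain ['X_i], so each of its elements stays in it
    after division by ['X_i]; by descent on size it is zero. *)
Lemma prime_codim1 (P : prime_idealr R) i :
  (forall f, f \in P <-> msubst [set i] (fun=> 0) f = 0) -> prime_codim P 1.
Proof.
move=> PE; have [Q QE] := subst_prime_exists set0 (fun=> 0).
have iP : 'X_i \in P by apply/PE; rewrite msubst_var inE eqxx mpolyC0.
have QP f : f \in Q -> f \in P.
  by move/QE => f0; apply/PE; apply: msubst_sub f0; apply: sub0set.
split.
  exists (fun j : 'I_2 => if j == ord0 then Q else P); split=> //.
  move=> [[|[|//]] ?] [[|[|//]] ?] //= _; split=> // H.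
  have /QE := H _ iP; rewrite msubst_var inE => /eqP.
  by rewrite (negPf (mpolyX_neq0 _)).
case=> [|[|m]] // [q [qP qlt]]; exfalso.
have j1 : (1 < m.+3)%N by [].
pose b := q (Ordinal j1).
have [bP nPb] : {subset b <= P} /\ ~ {subset P <= b}.
  have [H1 H2] := qlt (Ordinal j1) ord_max isT.
  by split=> [f /H1|H3]; [rewrite qP | apply: H2 => f; rewrite qP; apply: H3].
have [_ []] := qlt ord0 (Ordinal j1) isT.
have ib : 'X_i \notin b.
  apply/negP=> ib; apply: nPb => f /PE/mpoly_div_var[g ->].
  by rewrite mulrC; apply: idealMr.
suff b0 f : f \in b -> f = 0 by move=> f /b0->; apply: rpred0.
have [d] := ubnP (msize f); elim: d f => // d IHd f /ltnSE fd fb.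
apply/eqP; apply: contraT => f0.
have /PE/mpoly_div_var[g fE] := bP f fb.
have g0 : g != 0 by apply: contraNneq f0 => g0; rewrite fE g0 mulr0.
have gd : (msize g < d)%N.
  move: fd; rewrite fE msizeM ?mpolyX_neq0 //.
  by rewrite (@mmeasureX _ _ mdeg) /= mdeg1.
by move: fb; rewrite fE prime_idealrM (negPf ib) /= => /(IHd g gd)/eqP; rewrite (negPf g0).
Qed.

End PrimeChains.

Section Quotients.
Local Open Scope quotient_scope.
Variables (R : comNzRingType) (I : idealr R).

Lemma pi_eq0 (f : R) : (\pi_({ideal_quot I}) f == 0) = (f \in I).
Proof. by rewrite -[f in RHS]subr0 Quotient.idealrBE pi_zeror. Qed.

Lemma repr_piB (f : R) : f - repr (\pi_({ideal_quot I}) f) \in I.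
Proof. by rewrite Quotient.idealrBE reprK. Qed.

Lemma quot_prime_exists (P : prime_idealr R) : {subset I <= P} ->
  exists Q : prime_idealr {ideal_quot I}, forall f, (\pi f \in Q) = (f \in P).
Proof.
move=> IP; have piP f : (repr (\pi_({ideal_quot I}) f) \in P) = (f \in P).
  by rewrite -[repr _](subKr f) rpredBr // IP // repr_piB.
have [||||x y|Q QE] := @prime_of_closed {ideal_quot I} (fun x => repr x \in P).
- by rewrite -(rmorph0 \pi_({ideal_quot I})) piP rpred0.
- by elim/quotW=> f; elim/quotW=> g; rewrite !piP => fP gP; rewrite -rmorphD piP rpredD.
- by elim/quotW=> f; elim/quotW=> g; rewrite !piP => gP; rewrite -rmorphM piP idealMr.
- by rewrite -(rmorph1 \pi_({ideal_quot I})) piP idealr1.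
- elim/quotW: x => f; elim/quotW: y => g.
  by rewrite -rmorphM !piP prime_idealrM => /orP.
by exists Q => f; rewrite -(piP f); apply/idP/idP => /QE.
Qed.
End Quotients.

(** * The dual complex of a Cohen-Macaulay monomial ideal of codimension two *)

Section MonomialIdeal.
Local Open Scope quotient_scope.
Variables (k : fieldType) (n : nat) (I : idealr {mpoly k[n]}).
Hypothesis I_monomial : monomial_ideal I.
Local Notation R := {mpoly k[n]}.
Local Notation A := {ideal_quot I}.
Implicit Types (f : R) (S T W : {set 'I_n}) (m : 'X_{1..n}).

Lemma monomial_ideal_supp f : f \in I -> supported (fun m => 'X_[m] \in I) f.
Proof.
have [G GE] := I_monomial; have Iup m m' : 'X_[m'] \in I -> 'X_[m + m'] \in I.
  by rewrite mpolyXD; apply: idealMr.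
move=> /GE; apply: ideal_span_min; [exact: supported0 | exact: supportedD | |].
  by move=> c a aI; apply: supportedM => m m' _ /aI; apply: Iup.
move=> _ [m Gm ->] m' /mem_msuppXP <-; apply/GE; apply: ideal_span_gen.
by exists m.
Qed.

(* The Alexander dual of the Stanley-Reisner complex of the radical of [I]:   *)
(* [S] is not in it exactly when [I] is contained in the prime generated by   *)
(* the variables with index in [S]. *)
Definition dual_complex : {set {set 'I_n}} :=
  [set S | `[< exists2 m, 'X_[m] \in I & avoids S m >]].

Local Notation D := dual_complex.

Lemma dual_complexP S :
  reflect (exists2 m, 'X_[m] \in I & avoids S m) (S \in D).
Proof. by rewrite inE; apply: asboolP. Qed.

Lemma dual_complex_sub S T : S \subset T -> T \in D -> S \in D.
Proof.
move=> ST /dual_complexP[m mI /forall_inP Tm]; apply/dual_complexP; exists m => //.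
by apply/forall_inP => i iS; apply/Tm/(subsetP ST).
Qed.

Lemma nonface_msubst S f : S \notin D -> f \in I -> msubst S (fun=> 0) f = 0.
Proof.
move=> SD /monomial_ideal_supp fI; apply/msubst0_eq0 => m /fI mI.
by apply: contra SD => Sm; apply/dual_complexP; exists m.
Qed.

Hypothesis I_codim : ideal_codim I 2.

Lemma codim2_single i : [set i] \in D.
Proof.
have [_ Imin] := I_codim; apply: contraT => iD.
have [P PE] := @subst_prime_exists k n [set i] (fun=> 0).
suff : (2 <= 1)%N by [].
refine (Imin P 1%N _ (prime_codim1 PE)) => f fI; apply/PE.
exact: nonface_msubst iD fI.
Qed.

(** For a codimension [2] prime [P] over [I], the variables in [P] form a nonface. Three of them
    would give the chain [0], [(a)], [(a, b)], [P]; fewer than two are excluded because [I] has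
    codimension [2]. *)
Lemma codim2_edge : exists i j, nonface2 D i j.
Proof.
have [[P [IP [_ Pmax]]] Imin] := I_codim.
pose T := [set i | 'X_i \in P].
have TD : T \notin D.
  apply/negP => /dual_complexP[m /IP /prime_monomial[i mi iP] /forall_inP/(_ i)].
  by rewrite inE => /(_ iP); rewrite (negPf mi).
have T2 : (#|T| <= 2)%N.
  rewrite leqNgt; apply/negP => /card_gt2P[a [b [c [[aT bT cT] [ab bc ca]]]]].
  have [Q0 Q0E] := @subst_prime_exists k n set0 (fun=> 0).
  have [Q1 Q1E] := @subst_prime_exists k n [set a] (fun=> 0).
  have [Q2 Q2E] := @subst_prime_exists k n [set a; b] (fun=> 0).
  have Qlt S S' (Q Q' : prime_idealr R) v :
      (forall f, f \in Q <-> msubst S (fun=> 0) f = 0) ->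
      (forall f, f \in Q' <-> msubst S' (fun=> 0) f = 0) -> S \subset S' ->
      v \in S' -> v \notin S -> {subset Q <= Q'} /\ ~ {subset Q' <= Q}.
    move=> QE QE' SS vS' vS; split=> [f /QE f0|H].
      by apply/QE'; apply: msubst_sub f0.
    have : 'X_v \in Q by apply: H; apply/QE'; rewrite msubst_var vS' mpolyC0.
    by move/QE/eqP; rewrite msubst_var (negPf vS) (negPf (mpolyX_neq0 _ _)).
  have QP S (Q : prime_idealr R) :
      (forall f, f \in Q <-> msubst S (fun=> 0) f = 0) -> S \subset T -> c \notin S ->
      {subset Q <= P} /\ ~ {subset P <= Q}.
    move=> QE ST cS; split=> [f /QE/msubst0_eq0 f0|H].
      rewrite [f]mpolyE big_seq; apply: rpred_sum => m /f0.
      rewrite negb_forall => /existsP[i]; rewrite negb_imply => /andP[iS mi].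
      rewrite -(@submK _ U_(i)%MM m) ?lep1mP // mpolyXD scalerAl.
      by apply: idealMr; have := subsetP ST i iS; rewrite inE.
    have : 'X_c \in Q by apply: H; move: cT; rewrite inE.
    by move/QE/eqP; rewrite msubst_var (negPf cS) (negPf (mpolyX_neq0 _ _)).
  suff : (3 <= 2)%N by [].
  apply: Pmax; exists (fun i : 'I_4 => nth P [:: Q0; Q1; Q2] i); split=> //.
  have ca' : c \notin [set a] by rewrite inE.
  have cab : c \notin [set a; b] by rewrite !inE negb_or ca eq_sym.
  have abT : [set a; b] \subset T by rewrite subUset !sub1set aT.
  have aT' : [set a] \subset T by rewrite sub1set.
  have bA : b \notin [set a] by rewrite inE eq_sym.
  have [aab aa] : [set a] \subset [set a; b] /\ a \in [set a; b].
    by rewrite sub1set !inE eqxx.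
  have bb : b \in [set a; b] by rewrite !inE eqxx orbT.
  move=> [[|[|[|[|//]]]] ?] [[|[|[|[|//]]]] ?] //= _.
  - by apply: (Qlt _ _ _ _ a Q0E Q1E); rewrite ?sub0set ?inE.
  - by apply: (Qlt _ _ _ _ a Q0E Q2E); rewrite ?sub0set // inE.
  - by apply: (QP _ _ Q0E); rewrite ?sub0set // inE.
  - exact: (Qlt _ _ _ _ b Q1E Q2E).
  - exact: (QP _ _ Q1E).
  - exact: (QP _ _ Q2E).
have D0 : set0 \in D.
  apply: contraT => D0; have [Q QE] := @subst_prime_exists k n set0 (fun=> 0).
  suff : (2 <= 0)%N by [].
  have Q0 : prime_codim Q 0.
    apply: prime_codim0 => f /QE/msubst0_eq0 f0; apply/eqP; rewrite -msupp_eq0.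
    case E : (msupp f) => [//|m l]; have := f0 m; rewrite E mem_head => /(_ isT).
    by case/negP; apply/forall_inP => i; rewrite inE.
  refine (Imin Q 0%N _ Q0) => f fI; apply/QE.
  exact: nonface_msubst D0 fI.
case cT : #|T| T2 => [|[|[|//]]] _.
- by move: TD; move/eqP: cT; rewrite cards_eq0 => /eqP->; rewrite D0.
- have /cards1P[i Ti] : #|T| == 1%N by rewrite cT.
  by move: TD; rewrite Ti codim2_single.
have /cards2P[i [j [_ Tij]]] : #|T| == 2%N by rewrite cT.
by exists i, j; rewrite /nonface2 -Tij.
Qed.

Local Notation piA := (\pi_({ideal_quot I}) : R -> A).

Lemma edge_msubst T x i j f : nonface2 D i j -> i \in T -> j \in T ->
  x i = 0 -> x j = 0 -> f \in I -> msubst T x f = 0.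
Proof.
move=> ijD iT jT xi xj /monomial_ideal_supp fI.
rewrite [f]mpolyE big_seq /msubst rmorph_sum big1 //= => m /fI mI.
rewrite comp_mpolyZ -/(msubst T x _) msubst_monomial.
have [l [lT xl ml]] : exists l, [/\ l \in T, x l = 0 & m l != 0%N].
  have [mi|mi] := eqVneq (m i) 0%N; last by exists i.
  exists j; split=> //; apply: contraNneq ijD => mj.
  apply/dual_complexP; exists m => //; apply/forall_inP => l.
  by rewrite !inE => /orP[]/eqP->; apply/eqP.
by rewrite (bigD1 l) //= lT xl mpolyC0 expr0n (negPf ml) mul0r scaler0.
Qed.

Lemma edge_neq i j : nonface2 D i j -> i != j.
Proof. by apply: contraNneq => ->; rewrite setUid codim2_single. Qed.

(** The linear space [x_i = x_j = 0] lies in the zero set of [I]; fixing its other [n - 2]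
    coordinates one at a time gives the chain of primes. *)
Lemma point_codim x i j : nonface2 D i j -> x i = 0 -> x j = 0 ->
  exists M : prime_idealr A, [/\ forall f, piA f \in M <-> msubst setT x f = 0,
    prime_chain M (n - 2) & maximal_ideal M].
Proof.
move=> ijD xi xj.
pose s := enum (~: [set i; j]).
have sn : size s = (n - 2)%N.
  rewrite -cardE; have := cardsC [set i; j].
  by rewrite cards2 (edge_neq ijD) card_ord => /(congr1 (subn^~ 2)); rewrite addKn.
pose T d := [set l | (l \notin s) || (l \in take d s)].
have ijT d : i \in T d /\ j \in T d by rewrite !inE !mem_enum !inE !eqxx orbT.
have /fin_all_exists[Q QE] (d : 'I_(n - 2).+1) :
    exists Q : prime_idealr A, forall f, piA f \in Q <-> msubst (T d) x f = 0.
  have [P PE] := subst_prime_exists (T d) x; have [iT jT] := ijT d.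
  have [|Q QP] := @quot_prime_exists _ I P.
    by move=> f fI; apply/PE; exact: (edge_msubst ijD iT jT xi xj fI).
  by exists Q => f; rewrite QP; apply: PE.
have Tmax : T (@ord_max (n - 2)) = setT.
  by apply/setP=> l; rewrite !inE /= -sn take_size orNb.
exists (Q ord_max); split.
- by move=> f; rewrite QE Tmax.
- exists Q; split=> // d e de.
  have le_take : {subset take d s <= take e s}.
    by move=> l; rewrite -[take d s](@take_takel _ d e) ?(ltnW de) // => /mem_take.
  have TT : T d \subset T e.
    by apply/subsetP => l; rewrite !inE => /orP[->//|/le_take->]; rewrite orbT.
  split=> [|H]; first by elim/quotW=> f /QE f0; apply/QE; apply: msubst_sub f0.
  have ds : (d < size s)%N by rewrite sn (leq_trans de) // -ltnS.
  pose l := nth i s d; have ls : l \in s by apply: mem_nth.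
  have idx : index l s = d by rewrite index_uniq ?enum_uniq.
  have lT : l \notin T d by rewrite inE ls /= in_take // idx ltnn.
  have lT' : l \in T e by rewrite inE in_take // idx de orbT.
  have : piA ('X_l - (x l)%:MP) \in Q d.
    by apply: H; apply/QE; rewrite msubst_var_sub lT'.
  by move/QE/eqP; rewrite msubst_var_sub (negPf lT) (negPf (var_sub_neq0 _ _)).
move=> J MJ; elim/quotW=> f fJ; apply/QE; rewrite Tmax msubst_setT.
have : piA (f - (f.@[x])%:MP) \in J.
  by apply: MJ; apply/QE; rewrite Tmax msubst_setT mevalB mevalC subrr.
have [->|fx0] := eqVneq f.@[x] 0; first by rewrite mpolyC0.
rewrite rmorphB /= => fcJ; have := rpredB fJ fcJ; rewrite subKr => cJ.
have : piA (f.@[x]^-1)%:MP * piA (f.@[x])%:MP \in J by apply: idealMr.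
by rewrite -rmorphM -mpolyCM mulVf // mpolyC1 rmorph1 idealr1.
Qed.

Hypothesis I_CM : cohen_macaulay A.

(** A prime containing the maximal ideal of the point equals it, so its depth is its prime
    codimension, at least the length of the chain in [point_codim]. *)
Lemma point_regular_seq x i j : nonface2 D i j -> x i = 0 -> x j = 0 ->
  exists s : seq A, [/\ regular_seq s, (n - 2 <= size s)%N
    & forall f, piA f \in s -> msubst setT x f = 0].
Proof.
move=> ijD xi xj; have [M [ME Mchain Mmax]] := point_codim ijD xi xj.
have [d [[[s [reg sM sd]] _] [[P [MP [_ Pmax]]] _]]] := I_CM Mmax.
exists s; split=> // [|f /sM/ME//].
rewrite sd; apply: Pmax; have [q [qM qlt]] := Mchain; exists q; split=> // f.
by rewrite qM; apply/idP/idP => [/MP|]//; apply: Mmax.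
Qed.

(** One exponent for all faces bridges the gap between [I] and its radical. *)
Lemma uniform_power : exists N, forall S, S \in D ->
  'X_[mesym1 (~: S) *+ N.+1] \in I.
Proof.
have /fin_all_exists[m mS] S : exists m, S \in D -> 'X_[m] \in I /\ avoids S m.
  have [/dual_complexP[m mI Sm]|_] := boolP (S \in D); last by exists 0%MM.
  by exists m.
exists (\max_S mdeg (m S)) => S SD; have [mI /forall_inP Sm] := mS S SD.
have le_m : (m S <= mesym1 (~: S) *+ (\max_S mdeg (m S)).+1)%MM.
  apply/mnm_lepP => i; rewrite mulmnE mnmE inE.
  have [/Sm/eqP->//|_] := boolP (i \in S); rewrite mul1n.
  apply: leqW; apply: leq_trans (leq_bigmax S); rewrite mdegE.
  by rewrite (bigD1 i) //= leq_addr.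
by rewrite -(submK le_m) mpolyXD; apply: idealMr.
Qed.

Section Point.
Variables (W : {set 'I_n}) (N : nat).
Hypothesis N_gt0 : (0 < N)%N.
Implicit Types v : {set 'I_n} -> R.

Definition point (i : 'I_n) : k := (i \notin W)%:R.

(** These generate the maximal ideal of [point] up to radical, which is all that [koszul_depth]
    asks. *)
Definition point_gens (i : 'I_n) : R := if i \in W then 'X_i ^+ N else 'X_i - 1.

Lemma point_gens_radical (B : comNzRingType) (phi : {rmorphism R -> B}) f :
  msubst setT point f = 0 ->
  radical (ideal_span (fun b => exists l, b = phi (point_gens l))) (phi f).
Proof.
move=> f0; set J := ideal_span _.
have radD a b : radical J a -> radical J b -> radical J (a + b).
  exact: radical_ideal_spanD.
have radM c a : radical J a -> radical J (c * a) by exact: radical_ideal_spanM.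
have rad0 : radical J 0 by exact/radical_ideal_span/ideal_span0.
have radX i : radical J (phi ('X_i - (point i)%:MP)).
  have : J (phi (point_gens i)) by apply: ideal_span_gen; exists i.
  rewrite /point_gens /point; case: ifP => iW Ji; last first.
    by rewrite mpolyC1; apply: radical_ideal_span.
  by rewrite mpolyC0 subr0; exists N.-1; rewrite prednK // -rmorphXn.
move: (radical J) radD radM rad0 radX => rad radD radM rad0 radX.
pose V g := rad (phi (g - msubst setT point g)).
have VM g h : V g -> V h -> V (g * h).
  rewrite /V (rmorphM (msubst setT point)).
  set g' := msubst _ _ g; set h' := msubst _ _ h => Vg Vh.
  have -> : g * h - g' * h' = h * (g - g') + g' * (h - h') by ring.
  by rewrite (rmorphD phi) !(rmorphM phi); apply: radD; apply: radM.
have VC c : V c%:MP by rewrite /V msubstC subrr rmorph0.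
have VD g h : V g -> V h -> V (g + h).
  by move=> Vg Vh; rewrite /V msubstD opprD addrACA (rmorphD phi); apply: radD.
have VX i : V 'X_i by rewrite /V msubst_var inE.
suff : V f by rewrite /V f0 subr0.
clearbody V; elim/mpolyind: f {f0} => [|c m f _ _ Vf].
  by rewrite -(mpolyC0 n); apply: VC.
apply: VD => //; rewrite -mul_mpolyC; apply: (VM) => //.
rewrite mpolyXE_id; apply: (big_ind V) => [|g h|i _]; [|exact: (VM)|].
  by rewrite -(mpolyC1 n).
elim: (m i) => [|d IHd]; first by rewrite expr0 -(mpolyC1 n).
by rewrite exprS; apply: VM.
Qed.

(* Turns Koszul relations modulo [I] into relations between simplicial chains *)
(* of [D] restricted to [W]. *)
Definition point_coef S f : k := (msubst (~: W) (fun=> 1) f)@_(mesym1 (W :\: S) *+ N).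

Lemma point_coefD S f g : point_coef S (f + g) = point_coef S f + point_coef S g.
Proof. by rewrite /point_coef msubstD mcoeffD. Qed.

Lemma point_coefZ S c f : point_coef S (c *: f) = c * point_coef S f.
Proof. by rewrite /point_coef msubstZ mcoeffZ. Qed.

Lemma msubst1_monomial m : msubst (~: W) (fun=> 1) 'X_[m] =
  'X_[[multinom m i * (i \in W) | i < n]] :> R.
Proof.
rewrite msubst_monomial [RHS]mpolyXE_id; apply: eq_bigr => i _.
by rewrite mnmE inE; case: (i \in W); rewrite ?muln1 // muln0 mpolyC1 expr1n.
Qed.

Lemma point_coef_ideal S f : S \subset W -> S \notin D -> f \in I ->
  point_coef S f = 0.
Proof.
move=> SW SD /monomial_ideal_supp fI.
rewrite [f]mpolyE big_seq.
apply: (big_ind (fun g => point_coef S g = 0)) => [|g h Sg Sh|m /fI mI].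
- by rewrite /point_coef msubst0 mcoeff0.
- by rewrite point_coefD Sg Sh addr0.
rewrite point_coefZ /point_coef msubst1_monomial mcoeffX.
case: eqP => [/mnmP E|_]; last by rewrite mulr0.
case/negP: SD; apply/dual_complexP; exists m => //; apply/forall_inP => i iS.
by have := E i; rewrite !mnmE mulmnE mnmE inE iS (subsetP SW) // muln1 => ->.
Qed.

Lemma point_coef_gens S j f : j \notin S ->
  point_coef S (point_gens j * f) = if j \in W then point_coef (j |: S) f else 0.
Proof.
move=> jS; rewrite /point_coef /point_gens rmorphM /=; case: ifP => jW; last first.
  by rewrite rmorphB /= rmorph1 msubst_var inE jW subrr mul0r mcoeff0.
rewrite rmorphXn /= msubst_var inE jW /= mpolyXn mulrC.
have -> : (mesym1 (W :\: S) *+ N = U_(j) *+ N + mesym1 (W :\: (j |: S)) *+ N)%MM.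
  apply/mnmP => i; rewrite mnmDE !mulmnE !mnmE !inE -mulnDl; congr (_ * N)%N.
  by have [->|] := eqVneq i j; rewrite ?jS ?jW.
by rewrite mcoeffMX.
Qed.

Lemma point_coef_self S c : S \subset W ->
  point_coef S (c *: 'X_[mesym1 (~: S) *+ N]) = c.
Proof.
move=> SW; rewrite point_coefZ /point_coef msubst1_monomial mcoeffX.
rewrite (_ : (_ == _) = true) ?mulr1 //; apply/eqP/mnmP => i.
by rewrite !mnmE !mulmnE !mnmE !inE; case: (i \in S); case: (i \in W); rewrite ?muln1 ?muln0.
Qed.

End Point.

(** Weighting a simplex [t] by the [N]-th power of the variables outside [t] turns [u] into a Koszul
    cycle modulo [I], as the boundary of [u] lies in [D]. The depth bound makes it a boundary of
    some [v]. The chain [u] minus the boundary of the coefficients of [v] then consists of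
    coefficients of elements of [I], which vanish off [D]. *)
Lemma filling_of_regular_seq (B : comNzRingType) (phi : {rmorphism R -> B})
    (s : seq B) W d (u : {set 'I_n} -> k) :
  (forall f, phi f = 0 <-> f \in I) -> (forall b, exists f, b = phi f) ->
  regular_seq s -> (n - 2 <= size s)%N ->
  (forall f, phi f \in s -> msubst setT (point W) f = 0) ->
  (3 <= d)%N -> kdeg d u ->
  (forall t, u t != 0 -> t \subset W) -> (forall t, bdry u t != 0 -> t \in D) ->
  exists c, [/\ kdeg d c, forall t, c t != 0 -> t \in D /\ t \subset W
              & forall t, bdry c t = bdry u t].
Proof.
move=> phi0 phi_surj sreg sn sW d3 du uW uD.
have [N0 NI] := uniform_power; set N := N0.+1 in NI.
pose y i := phi (point_gens W N i).
pose uh t := phi (u t *: 'X_[mesym1 (~: t) *+ N]).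
have ksignE j t : ksign B j t = phi (ksign k j t)%:MP.
  by rewrite /ksign !rmorphXn /= mpolyCN mpolyC1 rmorphN1.
have uh_cycle t : kdiff y uh t = 0.
  transitivity (phi (bdry u t *: 'X_[mesym1 (~: t) *+ N])).
    rewrite /kdiff /bdry /kdiff scaler_suml (rmorph_sum phi); apply: eq_bigr => j jt.
    rewrite mul1r ksignE /y /uh -!(rmorphM phi); congr (phi _).
    rewrite -[RHS]mul_mpolyC mpolyCM -[RHS]mulrA; congr (_ * _).
    have [->|/uW /subsetP/(_ j)] := eqVneq (u (j |: t)) 0.
      by rewrite scale0r mulr0 mpolyC0 mul0r.
    rewrite setU11 => /(_ isT) jW; rewrite /point_gens jW.
    rewrite -scalerAr mul_mpolyC mpolyXn -mpolyXD; congr (_ *: 'X_[_]).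
    apply/mnmP => i; rewrite mnmDE !mulmnE !mnmE !inE -mulnDl; congr (_ * _)%N.
    by have [->|] := eqVneq i j; rewrite ?jt // eq_sym => /negPf->.
  have [->|/uD/NI XI] := eqVneq (bdry u t) 0; first by rewrite scale0r (rmorph0 phi).
  by apply/phi0; rewrite -mul_mpolyC; apply: idealMr.
have y_rad b : b \in s -> radical (ideal_span (fun x => exists l, x = y l)) b.
  have [f ->] := phi_surj b => /sW f0.
  exact: (@point_gens_radical W N _ B phi f f0).
have nil0 (b : B) : seq_ideal [::] b -> b = 0.
  move: b; apply: (@ideal_span_min _ _ (fun b => b = 0)) => // [a c -> ->|c a ->].
    by rewrite addr0.
  by rewrite mulr0.
have [||t|t|v dv Hv] := @koszul_depth B n y s sreg y_rad (size s) 0 d uh.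
- by rewrite add0n.
- by move: d3 sn; clear; move: (size s) => z; lia.
- by move=> td; rewrite /uh du // scale0r (rmorph0 phi).
- by rewrite uh_cycle take0; apply: ideal_span0.
have /fin_all_exists[vr vrE] t :
    exists f, v t = phi f /\ (#|t| != d.+1 -> f = 0).
  have [td|td] := eqVneq #|t| d.+1.
    by have [f ->] := phi_surj (v t); exists f.
  by exists 0; rewrite dv // (rmorph0 phi).
pose v' (t : {set 'I_n}) := if t \subset W then point_coef W N t (vr t) else 0.
pose c (t : {set 'I_n}) := u t - bdry v' t.
have cE (t : {set 'I_n}) : t \subset W -> c t = point_coef W N t (u t *: 'X_[mesym1 (~: t) *+ N]
    - \sum_(j | j \notin t) (ksign k j t)%:MP * (point_gens W N j * vr (j |: t))).
  move=> tW; rewrite /point_coef raddfB /= mcoeffB.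
  rewrite -/(point_coef W N t (u t *: _)) point_coef_self //; congr (_ - _).
  rewrite (rmorph_sum (msubst _ _)) raddf_sum; apply: eq_bigr => j jt /=.
  rewrite mul1r mul_mpolyC msubstZ mcoeffZ -/(point_coef W N t _); congr (_ * _).
  rewrite point_coef_gens // /v' subUset sub1set tW andbT.
  by case: ifP.
have cI (t : {set 'I_n}) : u t *: 'X_[mesym1 (~: t) *+ N]
    - \sum_(j | j \notin t) (ksign k j t)%:MP * (point_gens W N j * vr (j |: t)) \in I.
  apply/phi0; rewrite (rmorphB phi) (rmorph_sum phi) -/(uh t).
  have := Hv t; rewrite take0 => /nil0 E; rewrite -[RHS]E.
  congr (_ - _); rewrite /kdiff; apply: eq_bigr => j jt.
  rewrite !(rmorphM phi) -ksignE; congr (_ * (_ * _)).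
  by have [-> _] := vrE (j |: t).
have v'0 (t : {set 'I_n}) : ~~ (t \subset W) -> v' t = 0 by rewrite /v' => /negPf->.
exists c; split.
- move=> t td; rewrite /c du // sub0r /bdry /kdiff big1 ?oppr0 // => j jt.
  have [_ vr0] := vrE (j |: t).
  rewrite /v' vr0 ?cardsU1 ?jt ?add1n ?eqSS // /point_coef msubst0 mcoeff0.
  by case: ifP; rewrite !mulr0.
- move=> t; have [tW|tW] := boolP (t \subset W); last first.
    rewrite /c /bdry /kdiff big1 ?subr0 => [/uW|j jt]; first by rewrite (negPf tW).
    rewrite v'0 ?mulr0 //; apply: contraNN tW; apply: subset_trans.
    exact: subsetUr.
  rewrite cE // => ct; split=> //; apply: contraNT ct => tD.
  by rewrite (point_coef_ideal _ tW tD (cI t)).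
by move=> t; rewrite /c /bdry kdiffB kdiff_sq subr0.
Qed.

Lemma dual_complex_filling : filling k D.
Proof.
move=> W d u [i [j [iW jW ij]]].
have [||s [sreg sn sW]] := @point_regular_seq (point W) i j ij.
- by rewrite /point iW.
- by rewrite /point jW.
have phi0 f : piA f = 0 <-> f \in I by split=> [/eqP|fI]; [|apply/eqP]; rewrite pi_eq0.
have phi_surj (b : A) : exists f, b = piA f by exists (repr b); rewrite reprK.
exact: (@filling_of_regular_seq A \pi_A s W d u phi0 phi_surj sreg sn sW).
Qed.

End MonomialIdeal.

(** * The prime with prescribed initial ideal *)

(** A regular sequence without constant terms is algebraically independent, so [k[s, t]] embeds by
    [s] to [f] and [t] to [g]. The last clause is induction over [k[s, t]]. *)
Lemma generic_parameters (k : fieldType) (n : nat) (f g : {mpoly k[n]}) :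
  f != 0 -> f@_0%MM = 0 -> g@_0%MM = 0 ->
  (forall y z, y * f + z * g = 0 -> exists c, y = c * g /\ z = - (c * f)) ->
  exists (B : idomainType) (c0 : {rmorphism k -> B})
         (sigma : {rmorphism B -> {mpoly k[n]}}) (s t : B),
    [/\ forall a, sigma (c0 a) = a%:MP, forall b, sigma b = 0 -> b = 0,
        sigma s = f, sigma t = g
      & forall Q : B -> Prop, (forall b b', Q b -> Q b' -> Q (b + b')) ->
          (forall b b', Q b -> Q b' -> Q (b * b')) -> (forall a, Q (c0 a)) ->
          Q s -> Q t -> forall b, Q b].
Proof.
move=> f0 cf cg reg.
pose evg : {rmorphism {poly k} -> {mpoly k[n]}} :=
  horner_eval g \o map_poly (@mpolyC n k).
pose sigma : {rmorphism {poly {poly k}} -> {mpoly k[n]}} :=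
  horner_eval f \o map_poly evg.
have evgX : evg 'X = g by rewrite /= map_polyX /horner_eval hornerX.
have evgC a : evg a%:P = a%:MP by rewrite /= map_polyC /horner_eval hornerC.
have sX : sigma 'X = f by rewrite /= map_polyX /horner_eval hornerX.
have sC q : sigma q%:P = evg q by rewrite /= map_polyC /horner_eval hornerC.
clearbody sigma; clearbody evg.
(* Independence of [g] modulo [f]: constant terms remove [c], and regularity cancels the factor
   [g]. *)
have evg_inj q y : evg q = y * f -> q = 0.
  elim/poly_ind: q y => [//|q c IHq] y.
  rewrite rmorphD rmorphM evgX evgC => E.
  have c0 : c = 0.
    have := congr1 (mcoeff 0%MM) E; rewrite mcoeffD !rmorphM /= cf cg !mulr0 add0r.
    by rewrite mcoeffC eqxx mulr1.
  move: E; rewrite c0 mpolyC0 addr0 => E.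
  have /reg[c' [_ E']] : - y * f + evg q * g = 0 by rewrite E; ring.
  by rewrite (IHq (- c')) ?mul0r ?addr0 // E' mulNr.
exists {poly {poly k}}, (polyC \o polyC), sigma, 'X, 'X%:P; split=> //.
- by move=> a; rewrite /= sC evgC.
- elim/poly_ind => [//|p c IHp]; rewrite rmorphD rmorphM sX sC => E.
  have c0 : c = 0.
    by apply: (evg_inj c (- sigma p)); apply/eqP; rewrite mulNr -addr_eq0 addrC E.
  move: E; rewrite c0 rmorph0 addr0 => /eqP; rewrite mulf_eq0 (negPf f0) orbF.
  by move=> /eqP/IHp->; rewrite mul0r addr0.
- by rewrite sC evgX.
move=> Q QD QM QC Qs Qt; have Qq q : Q q%:P.
  elim/poly_ind: q => [|q c IHq]; first exact: QC 0.
  by rewrite polyCD polyCM; apply: QD; [apply: QM | apply: QC].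
elim/poly_ind => [|p c IHp]; first exact: Qq 0.
by apply: QD => //; apply: QM.
Qed.

Section Covers.
Variables (n : nat) (G : rel 'I_n).
Local Notation cov := (mcovers G setT).

Lemma mcoversP m : cov m <-> forall i j, G i j -> ~~ avoids [set i; j] m.
Proof.
split=> [H i j ij|H i j _ _ ij].
  apply/negP => /forall_inP av.
  by have [] := H i j (in_setT i) (in_setT j) ij; rewrite inE av // !inE eqxx ?orbT.
have := H i j ij; rewrite negb_forall => /existsP[l].
by rewrite negb_imply !inE => /andP[/orP[]/eqP->]; [left | right].
Qed.

(** The cover ideal is the intersection of the primes [('X_i, 'X_j)] over the edges, hence
    radical. *)
Lemma supported_radical (F : fieldType) (p : {mpoly F[n]}) d :
  supported cov (p ^+ d.+1) -> supported cov p.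
Proof.
move=> pd m mp; apply/mcoversP => i j ij; move: m mp; apply/msubst0_eq0.
have /eqP : msubst [set i; j] (fun=> 0) (p ^+ d.+1) = 0.
  by apply/msubst0_eq0 => m /pd/mcoversP; apply.
by rewrite rmorphXn expf_eq0 => /andP[_ /eqP].
Qed.

Variables (k K : fieldType) (iota : {rmorphism k -> K}).

Lemma msupp_map (p : {mpoly k[n]}) : msupp (map_mpoly iota p) =i msupp p.
Proof. by move=> m; rewrite !mcoeff_msupp mcoeff_map_mpoly fmorph_eq0. Qed.

Lemma supported_map P (p : {mpoly k[n]}) :
  supported P p -> supported P (map_mpoly iota p).
Proof. by move=> Pp m; rewrite msupp_map => /Pp. Qed.

Lemma dhomog_map d (p : {mpoly k[n]}) :
  p \is d.-homog -> map_mpoly iota p \is d.-homog.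
Proof. by move=> /dhomogP pd; apply/dhomogP => m; rewrite msupp_map => /pd. Qed.

Lemma in2_map (f g h : {mpoly k[n]}) :
  in2 f g h -> in2 (map_mpoly iota f) (map_mpoly iota g) (map_mpoly iota h).
Proof.
move=> [a [b ->]]; exists (map_mpoly iota a), (map_mpoly iota b).
by rewrite rmorphD !rmorphM.
Qed.

Lemma msubst0_map S (p : {mpoly k[n]}) :
  msubst S (fun=> 0) (map_mpoly iota p) = 0 <-> msubst S (fun=> 0) p = 0.
Proof. by rewrite !msubst0_eq0; split=> H m; have := H m; rewrite msupp_map. Qed.

End Covers.

(* The prime is [(f - s, g - t)] over the field [k(s, t)]. *)
Lemma stci_initial_prime (k : fieldType) (n : nat) (ge : rel 'X_{1..n}) (G : rel 'I_n)
    (f g : {mpoly k[n]}) (d1 d2 : nat) :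
  monomial_order ge -> respects_degree ge ->
  (exists i j, G i j) -> (forall i, G i i = false) ->
  f \is d1.-homog -> g \is d2.-homog ->
  supported (mcovers G setT) f -> supported (mcovers G setT) g ->
  (forall T, covers G setT T -> exists N, in2 f g (sqfree k T ^+ N)) ->
  exists (K : fieldType) (iota : {rmorphism k -> K}) (P : prime_idealr {mpoly K[n]}),
    forall h : {mpoly K[n]},
      radical (initial_ideal ge P) h <-> supported (mcovers G setT) h.
Proof.
move=> [ge_anti _ ge_total _ _] ge_deg [i0 [j0 ij0]] Girr df dg fG gG fgG.
set cov := mcovers G setT in fG gG *.
have cov_up m m' : cov m' -> cov (m + m')%MM by apply: mcovers_up.
have ncov0 : ~ cov 0%MM.
  by move/mcoversP/(_ _ _ ij0)/negP; apply; apply/forall_inP => l _; rewrite mnm0E.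
have ncov1 (F : fieldType) : ~ supported cov (1 : {mpoly F[n]}).
  by move/(_ 0%MM); rewrite mcoeff_msupp mcoeff1 eqxx oner_eq0 => /(_ isT).
have covD1 v : covers G setT (~: [set v]).
  move=> i j _ _ ij; have [iv|iv] := eqVneq i v; last by left; rewrite !inE iv.
  by right; rewrite !inE; apply: contraTneq ij => jv; rewrite iv jv Girr.
(* All vertices but [v] form a cover, so [(f, g)] contains a monomial prime to ['X_v]. *)
have fg_var v : msubst [set v] (fun=> 0) f = 0 -> msubst [set v] (fun=> 0) g != 0.
  move=> fv; apply/eqP => gv; have [N [a [b E]]] := fgG _ (covD1 v).
  have := congr1 (msubst [set v] (fun=> 0)) E.
  rewrite rmorphD !rmorphM /= fv gv !mulr0 addr0 mpolyXn msubst0_monomial.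
  rewrite (_ : avoids _ _) ?mul1r => [/eqP|]; first by rewrite (negPf (mpolyX_neq0 _ _)).
  by apply/forall_inP => i; rewrite mulmnE mnmE !inE => ->.
(* Regularity serves over [k] for algebraic independence and over [K] for leading forms; the
   criterion survives extension of scalars. *)
have regular (F : fieldType) (phi : {rmorphism k -> F}) y z :
    y * map_mpoly phi f + z * map_mpoly phi g = 0 ->
    exists c, y = c * map_mpoly phi g /\ z = - (c * map_mpoly phi f).
  have [N fgN] := fgG _ (covD1 i0).
  apply: (@koszul_regular _ _ _ _ (mesym1 (~: [set i0]) *+ N)%MM).
    rewrite -(map_mpolyX phi) -mpolyXn; exact: in2_map fgN.
  by move=> v /msubst0_map fv; apply/eqP => /msubst0_map/eqP; rewrite (negPf (fg_var v fv)).
have {}regular' y z : y * f + z * g = 0 -> exists c, y = c * g /\ z = - (c * f).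
  have map_id (p : {mpoly k[n]}) : map_mpoly idfun p = p.
    by apply/mpolyP => m; rewrite mcoeff_map_mpoly.
  by have := regular k idfun y z; rewrite !map_id.
have f0 : f != 0.
  apply/eqP => f0; have [|c [E _]] := regular' 1 0; first by rewrite f0; ring.
  apply: (ncov1 k); rewrite E; apply: (supported_in2 cov_up fG gG).
  by exists 0, c; ring.
have g0 : g != 0.
  apply/eqP => g0; have [|c [_ E]] := regular' 0 1; first by rewrite g0; ring.
  apply: (ncov1 k); rewrite E; apply: (supported_in2 cov_up fG gG).
  by exists (- c), 0; ring.
have deg_gt0 (p : {mpoly k[n]}) d : p \is d.-homog -> supported cov p -> p != 0 -> (0 < d)%N.
  move=> /dhomogP pd pG; rewrite -msupp_eq0; case E : (msupp p) => [//|m l] _.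
  have mp : m \in msupp p by rewrite E mem_head.
  rewrite -(pd m mp) /= lt0n mdeg_eq0; apply: contraPneq (pG m mp) => ->.
  exact: ncov0.
have d1_gt0 := deg_gt0 _ _ df fG f0; have d2_gt0 := deg_gt0 _ _ dg gG g0.
have c00 (p : {mpoly k[n]}) : supported cov p -> p@_0%MM = 0.
  by move=> pG; apply: memN_msupp_eq0; apply/negP => /pG/ncov0.
have [B [c0 [sigma [s [t [sc0 s_inj ss st Bind]]]]]] :=
  generic_parameters f0 (c00 _ fG) (c00 _ gG) regular'.
have [K [tofrac [tof_inj tof_denom]]] : exists (K : fieldType) (tofrac : {rmorphism B -> K}),
    injective tofrac /\ forall x, exists a b, b != 0 /\ tofrac b * x = tofrac a.
  exists {fraction B}, (@FracField.tofrac B); split; last exact: fraction_denom.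
  by move=> x y /eqP; rewrite tofrac_eq => /eqP.
pose iota : {rmorphism k -> K} := tofrac \o c0.
have [P PE] := generic_prime_exists s_inj tof_inj tof_denom.
exists K, iota, P.
pose fK := map_mpoly iota f; pose gK := map_mpoly iota g.
pose sK := tofrac s; pose tK := tofrac t.
have gens h : in2 (fK - sK%:MP) (gK - tK%:MP) h <-> h \in P.
  have [Pf Pg] := @generic_ideal_gens k n B c0 sigma sc0 K tofrac f g s t ss st.
  split=> [[a [b ->]]|/PE].
    by apply: rpredD; apply: idealMr; apply/PE.
  apply: generic_idealP => //; apply: Bind => [b b' Qb Qb'|b b' Qb Qb'|a||].
  - rewrite (rmorphD tofrac) mpolyCD (rmorphD sigma) (rmorphD (map_mpoly _)).
    by rewrite opprD addrACA; apply: in2D.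
  - rewrite (rmorphM tofrac) mpolyCM (rmorphM sigma) (rmorphM (map_mpoly _)).
    exact: in2_congM.
  - by exists 0, 0; rewrite sc0 map_mpolyC /=; ring.
  - by exists (-1), 0; rewrite ss; ring.
  - by exists 0, (-1); rewrite st; ring.
have dfK : fK \is d1.-homog by apply: dhomog_map.
have dgK : gK \is d2.-homog by apply: dhomog_map.
have fKG : supported cov fK by apply: supported_map.
have gKG : supported cov gK by apply: supported_map.
move=> h; split=> [[d hd]|hG].
  apply: (@supported_radical _ _ _ _ d); move: hd; apply: ideal_span_min.
  - exact: supported0.
  - by move=> a b; apply: supportedD.
  - by move=> c a aG; apply: supportedM => m m' _ /aG; apply: cov_up.
  move=> _ [h' [/gens h'P _ [m [mh mmax ->]]]] m' /msuppZ_le/mem_msuppXP <-.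
  apply: (leading_form dfK dgK d1_gt0 d2_gt0 (regular K iota) cov_up fKG gKG h'P mh).
  move=> m1 m1h; rewrite leqNgt; apply/negP => /ge_deg[m1m].
  by apply; apply: ge_anti; rewrite m1m mmax.
have init_cover T : covers G setT T -> exists N, initial_ideal ge P ('X_[mesym1 T *+ N.+1]).
  move=> TG; have T_gt0 : (0 < #|T|)%N.
    by rewrite card_gt0; apply/set0Pn; have [iT|jT] := TG i0 j0 (in_setT _) (in_setT _) ij0;
      [exists i0 | exists j0].
  have [N0 fgN0] := fgG T TG; pose N := (N0 + d1 + d2)%N.
  exists N; apply: ideal_span_gen; pose D := (#|T| * N.+1)%N.
  have ND : (N < D)%N by rewrite /D leq_pmull.
  have [d1D d2D] : (d1 < D)%N /\ (d2 < D)%N.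
    by split; apply: leq_ltn_trans ND; rewrite /N; lia.
  have dX : ('X_[mesym1 T *+ N.+1] : {mpoly K[n]}) \is D.-homog.
    by rewrite dhomogX /= mdegMn mdeg_mesym1.
  have inX : in2 fK gK ('X_[mesym1 T *+ N.+1]).
    rewrite -(map_mpolyX iota) -mpolyXn.
    have -> : N.+1 = (d1 + d2 + 1 + N0)%N by rewrite /N; lia.
    by apply: in2_map; rewrite exprD; apply: in2M.
  have [a [b [da db E]]] := dhomog_in2 dfK dgK dX inX (ltnW d1D) (ltnW d2D).
  (* Replacing [fK], [gK] by the generators of [P] subtracts [sK *: a + tK *: b], of degree below
     [D], so the monomial is the initial term. *)
  pose h1 := a * (fK - sK%:MP) + b * (gK - tK%:MP).
  have h1E : h1 = 'X_[mesym1 T *+ N.+1] - (sK *: a + tK *: b).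
    by rewrite E -!mul_mpolyC /h1; ring.
  have low m : m \in msupp (sK *: a + tK *: b) -> (mdeg m < D)%N.
    move=> /msuppD_le; rewrite mem_cat => /orP[] /msuppZ_le.
      by move/(dhomogP _ _ _ da) => /= ->; rewrite ltn_subrL d1_gt0 (leq_trans _ ND).
    by move/(dhomogP _ _ _ db) => /= ->; rewrite ltn_subrL d2_gt0 (leq_trans _ ND).
  have degX : mdeg (mesym1 T *+ N.+1)%MM = D by rewrite mdegMn mdeg_mesym1.
  have h1X : h1@_(mesym1 T *+ N.+1) = 1.
    rewrite h1E mcoeffB mcoeffX eqxx [X in _ - X]memN_msupp_eq0 ?subr0 //.
    by apply/negP => /low; rewrite degX ltnn.
  have Xh1 : (mesym1 T *+ N.+1)%MM \in msupp h1 by rewrite mcoeff_msupp h1X oner_eq0.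
  exists h1; split; first by apply/gens; exists a, b.
    by apply: contraTneq Xh1 => ->; rewrite msupp0.
  exists (mesym1 T *+ N.+1)%MM; split=> //; last by rewrite h1X scale1r.
  move=> m; rewrite h1E => /msuppB_le; rewrite mem_cat => /orP[/mem_msuppXP <-|/low mD].
    by have := ge_total (mesym1 T *+ N.+1)%MM (mesym1 T *+ N.+1)%MM; rewrite orbb.
  by have [] := ge_deg (mesym1 T *+ N.+1)%MM m; rewrite // degX.
have rad_cover m : cov m -> radical (initial_ideal ge P) 'X_[m].
  move=> /init_cover[N mN]; exists N; rewrite mpolyXn.
  have le_m : (mesym1 (msup m) *+ N.+1 <= m *+ N.+1)%MM.
    apply/mnm_lepP => i; rewrite !mulmnE mnmE inE leq_pmul2r //.
    by case: (m i).
  by rewrite -(submK le_m) mpolyXD; apply: ideal_spanMl.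
rewrite [h]mpolyE big_seq; apply: (big_ind (radical (initial_ideal ge P))).
- exact/radical_ideal_span/ideal_span0.
- by move=> a b; apply: radical_ideal_spanD.
by move=> m /hG/rad_cover; rewrite -mul_mpolyC; apply: radical_ideal_spanM.
Qed.

Theorem theorem0p1 (r : nat) (k : fieldType) (ge : rel 'X_{1..r})
    (ge_order : monomial_order ge) (ge_degree : respects_degree ge)
    (I : idealr {mpoly k[r]}) (I_monomial : monomial_ideal I)
    (I_codim : ideal_codim I 2) (I_CM : cohen_macaulay {ideal_quot I}) :
  exists (K : fieldType) (iota : {rmorphism k -> K})
         (P : prime_idealr {mpoly K[r]}),
    forall f : {mpoly K[r]},
      radical (initial_ideal ge P) f
      <-> extended_ideal iota (radical (fun g => g \in I)) f.
Proof.
set D := dual_complex I; pose G := nonface2 D.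
have D_sub (s t : {set 'I_r}) : s \subset t -> t \in D -> s \in D by apply: dual_complex_sub.
have D1 i : [set i] \in D by apply: codim2_single.
have D_fill : filling k D by apply: dual_complex_filling.
have D_edge : exists i j, G i j by apply: codim2_edge.
have G_sym i j : G i j = G j i by apply: nonface2C.
have G_irr i : G i i = false by apply: nonface2_irr.
(* Flagness enters here: the complement of a cover contains no missing edge, hence is a face. *)
have cov_D T : covers G setT T -> ~: T \in D.
  move=> TG; apply: contraT => /(flag D_sub D1 D_fill D_edge)[i [j [iT jT ij]]].
  by have [T'|T'] := TG i j (in_setT i) (in_setT j) ij;
    [move: iT | move: jT]; rewrite inE T'.
have I_cov (p : {mpoly k[r]}) : p \in I -> supported (mcovers G setT) p.
  move=> pI m mp; apply/mcoversP => i j ij; move: m mp; apply/msubst0_eq0.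
  exact: nonface_msubst ij pI.
have [f [g [d1 [d2 [df dg fG gG fgG]]]]] :=
  @cover_ideal_stci k r G G_sym G_irr (simplicial_exists D_sub D1 D_fill) setT.
have [K [iota [P PE]]] :=
  stci_initial_prime ge_order ge_degree D_edge G_irr df dg fG gG fgG.
exists K, iota, P => h; rewrite PE; split=> [hG|].
  rewrite [h]mpolyE big_seq; apply: ideal_span_sum => m /hG mG.
  rewrite -mul_mpolyC; apply: ideal_spanMl; apply: ideal_span_gen.
  exists 'X_[m]; last by rewrite map_mpolyX.
  have /dual_complexP[m0 m0I /forall_inP av] := cov_D _ mG.
  exists (mdeg m0); rewrite mpolyXn.
  have le_m : (m0 <= m *+ (mdeg m0).+1)%MM.
    apply/mnm_lepP => i; rewrite mulmnE.
    have [mi|mi] := eqVneq (m i) 0%N; first by rewrite (eqP (av i _)) // !inE mi.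
    apply: leq_trans (leq_pmull _ _); last by rewrite lt0n.
    by apply: leqW; rewrite mdegE (bigD1 i) //= leq_addr.
  by rewrite -(submK le_m) mpolyXD; apply: idealMr.
apply: ideal_span_min.
- exact: supported0.
- by move=> a b; apply: supportedD.
- by move=> c a aG; apply: supportedM => m m' _ /aG; apply: mcovers_up.
move=> _ [p [d pI] ->]; apply: supported_map.
by apply: (@supported_radical _ _ _ _ d); apply: I_cov.
Qed.
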